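(* Let $k$ and $\ell$ be integers with $k\ge 3$ and $\ell \ge k^{12k}$, and let $G=(V_1\cup \ldots \cup V_{\ell},E)$ be a balanced $\ell$-partite graph on $n$ vertices such that \[ d(V_i,V_j) \ge \tfrac{k-2}{k-1} \quad \text{for all } i \ne j. \] Then $G$ either contains a family of at least $k^{-2k^2}n^{k-2}$ cliques of order $k$ all sharing a common edge, or is isomorphic to a graph in $\mathcal{G}_{\ell}^{k}$.
   Context: All graphs are finite, simple and undirected. An $\ell$-partite graph $G=(V_1\cup\ldots\cup V_\ell,E)$ is a graph whose vertex set is the disjoint union of non-empty independent sets $V_1,\ldots,V_\ell$ (its parts); it is balanced if all $V_i$ have the same size. The edge density is $d(V_i,V_j)=\frac{e(V_i,V_j)}{|V_i||V_j|}$. The family $\mathcal{G}_\ell^k$ (for $k\ge3$, $\ell\ge(k-1)!$): let $\pi_1,\ldots,\pi_{(k-1)!}$ be all permutations of $\{1,\ldots,k-1\}$. A graph is in $\bar{\mathcal G}_\ell^k$ if it can be constructed as follows. Pick non-negative integers $n_i^{s}$ ($1\le i\le\ell$, $1\le s\le k-1$) such that $n_i^{\pi_i(1)}\ge n_i^{\pi_i(2)}\ge\ldots\ge n_i^{\pi_i(k-1)}$ for $1\le i\le(k-1)!$; $n_i^1=n_i^2=\ldots=n_i^{k-1}>0$ for $(k-1)!<i\le\ell$; and $\sum_s n_i^s>0$ for $1\le i\le\ell$. The vertex set is $\{(i,s,t):1\le i\le\ell,\ 1\le s\le k-1,\ 1\le t\le n_i^s\}$ and the edge set is $\{(i,s,t)(i',s',t'):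 i\ne i',\ s\ne s'\}$. Then $\mathcal G_\ell^k$ is the family of graphs which can be obtained from graphs in $\bar{\mathcal G}_\ell^k$ by removing some (possibly no) edges in $\{(i,s,t)(i',s',t'):1\le i<i'\le(k-1)!\}$. *)

(* Defs.v *)
From HB Require Import structures.
From mathcomp Require Import all_boot all_order all_fingroup all_algebra.

Set Implicit Arguments.
Unset Strict Implicit.
Unset Printing Implicit Defensive.

Import Order.TTheory GRing.Theory Num.Theory.

Local Open Scope ring_scope.

Record graph (T : finType) := Graph {
  adj :> rel T;
  adj_sym : symmetric adj;
  adj_irr : irreflexive adj }.

Definition isomorphic (S T : finType) (G : graph S) (H : graph T) : Prop :=
  exists2 f : S -> T, bijective f & forall x y, G x y = H (f x) (f y).

Definition clique (T : finType) (G : graph T) (K : {set T}) : Prop :=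
  {in K &, forall x y, x != y -> G x y}.

Definition independent (T : finType) (G : graph T) (A : {set T}) : Prop :=
  {in A &, forall x y, ~~ G x y}.

Definition partite (T : finType) (G : graph T) (l : nat)
    (V : 'I_l -> {set T}) : Prop :=
  [/\ \bigcup_i V i = [set: T],
      forall i j, i != j -> [disjoint V i & V j],
      forall i, V i != set0
    & forall i, independent G (V i)].

Definition balanced (T : finType) (l : nat) (V : 'I_l -> {set T}) : Prop :=
  forall i j, #|V i| = #|V j|.

(* Only used for disjoint A and B, where each A-B edge is counted once. *)
Definition edges_between (T : finType) (G : graph T) (A B : {set T}) : nat :=
  #|[set p in setX A B | G p.1 p.2]|.

Definition density (T : finType) (G : graph T) (A B : {set T}) : rat :=
  (edges_between G A B)%:R / (#|A| * #|B|)%:R.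

(* Indices start at 0: the distinguished parts V_1, ..., V_{(k-1)!} are those
   of index i < (k.-1)`!, and pi enumerates the permutations of 'I_k.-1. *)
Section Family.

Variables (k l : nat).

Definition admissible (pi : 'I_(k.-1)`! -> 'S_k.-1)
    (n : 'I_l -> 'I_k.-1 -> nat) : Prop :=
  [/\ forall (i : 'I_l) (j : 'I_(k.-1)`!), i = j :> nat ->
        forall a b : 'I_k.-1, (a <= b)%N -> (n i (pi j b) <= n i (pi j a))%N,
      forall i : 'I_l, ((k.-1)`! <= i)%N ->
        forall s s' : 'I_k.-1, n i s = n i s' /\ (0 < n i s)%N
    & forall i : 'I_l, (0 < \sum_s n i s)%N].

(* The triples (i, s, t) with t < n i s. *)
Definition triple (n : 'I_l -> 'I_k.-1 -> nat) : finType :=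
  {i : 'I_l & {s : 'I_k.-1 & 'I_(n i s)}}.

Definition fst_index n (x : triple n) : 'I_l := tag x.
Definition snd_index n (x : triple n) : 'I_k.-1 := tag (tagged x).

Definition Gbar_adj n : rel (triple n) :=
  fun x y => (fst_index x != fst_index y) && (snd_index x != snd_index y).

Lemma Gbar_adj_sym n : symmetric (@Gbar_adj n).
Proof. by move=> x y; rewrite /Gbar_adj eq_sym [X in _ && ~~ X]eq_sym. Qed.

Lemma Gbar_adj_irr n : irreflexive (@Gbar_adj n).
Proof. by move=> x; rewrite /Gbar_adj eqxx. Qed.

Definition Gbar n : graph (triple n) :=
  Graph (@Gbar_adj_sym n) (@Gbar_adj_irr n).

(* H arises from Gbar n by deleting edges between triples whose first indices
   are both among the first (k-1)! ones. *)
Definition obtained_from_Gbar n (H : graph (triple n)) : Prop :=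
  (forall x y, H x y -> Gbar n x y) /\
  (forall x y, Gbar n x y -> ~~ H x y ->
     (fst_index x < (k.-1)`!)%N /\ (fst_index y < (k.-1)`!)%N).

Inductive Gfamily (pi : 'I_(k.-1)`! -> 'S_k.-1) :
    forall T : finType, graph T -> Prop :=
  Gfamily_intro n (H : graph (triple n)) of
    admissible pi n & obtained_from_Gbar H : Gfamily pi H.

End Family.

Arguments Gfamily k l pi [T] H.

(* Main.v *)
Require Import Defs.
From HB Require Import structures.
From mathcomp Require Import all_boot all_order all_fingroup all_algebra.
From mathcomp Require Import zify ring.

Set Implicit Arguments.
Unset Strict Implicit.
Unset Printing Implicit Defensive.

(** Write r = k - 1, let m be the common size of the parts, and call the set of
    k-cliques through a given edge a joint.  Suppose that every joint has fewer
    than k^(-2k^2) n^(k-2) members.  The heart of the matter is that G is then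
    r-colorable; Chebyshev's sum inequality does the rest.

    Why r-colorability suffices.  In a proper r-coloring let n_i^s be the number
    of vertices of color s in part i.  The density between parts i and j is at
    most 1 - (sum_s n_i^s n_j^s) / m^2.  If both parts rank the colors by
    frequency in the same order, this is at most 1 - 1/r, with equality only if
    one of the parts is uniform, that is, has r equally large classes; and then
    all pairs with different colors must be adjacent.  So two non-uniform parts
    never share a ranking, which leaves room for at most r! of them, and uniform
    parts are joined to everything that the coloring permits
    ([proper_coloring_in_family]).

    Why G is r-colorable.  Small joints mean few k-cliques in total, and the
    density is that of Turan's graph up to the pairs inside the parts.  A version
    of Furedi's proof of the stability theorem that tolerates a few cliques
    ([furedi]) therefore yields an r-coloring with few monochromatic edges; a
    maximum cut then has few monochromatic edges and few missing pairs, meaning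
    non-adjacent pairs with different colors ([good_coloring]).  Because the
    missing pairs are so few, a vertex with many neighbors in all classes, or an
    edge with many common neighbors in all but one class, would produce a large
    joint ([rich_joint]).

    This approximate structure becomes exact on a suitable set J of parts.  Each
    part ranks the colors in one of r! ways, so at least l/r! parts share a
    ranking.  On these, Chebyshev's inequality says that missing pairs are at
    most as numerous as monochromatic edges.  On the other hand every
    monochromatic edge has an endpoint with many missing pairs, while the maximum
    cut gives it few monochromatic edges.  Both numbers must therefore vanish
    ([ordered_parts_complete]), and by the equality case all but one of these
    parts are uniform ([ordered_parts_uniform]).

    The uniform parts of J form a core: a complete r-partite pattern with equal
    classes.  A vertex with neighbors in all core classes either lies in a large
    joint or has fewer core neighbors than the density demands on average.  Hence
    every vertex misses exactly one class of the core and is joined to all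
    others.  Coloring it by the class that it misses is proper, because two
    adjacent vertices of one color would have a large joint inside the core
    ([core_extends]). *)

(** * Stability in the style of Furedi *)

Section Counting.

Variables (T : finType) (G : graph T).

Definition nbr (x : T) : {set T} := [set y | G x y].

(** The number of j-cliques of W with an ordering of their vertices.  Ordered
    cliques satisfy this recursion exactly, which is what the greedy choice of
    vertices below consumes. *)
Fixpoint ordered_cliques (j : nat) (W : {set T}) : nat :=
  if j is i.+1 then \sum_(x in W) ordered_cliques i (W :&: nbr x) else 1.

(** Both counts run over ordered pairs, so for A = B every unordered pair counts
    twice. *)
Definition mono (C : eqType) (col : T -> C) (A B : {set T}) : nat :=
  \sum_(x in A) \sum_(y in B) (G x y && (col x == col y)).

Definition miss (C : eqType) (col : T -> C) (A B : {set T}) : nat :=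
  \sum_(x in A) \sum_(y in B) (~~ G x y && (col x != col y)).

Lemma sum_card (P : pred T) (A : {set T}) :
  \sum_(x in A) (P x : nat) = #|[set x in A | P x]|.
Proof.
rewrite -sum1_card big_mkcond [RHS]big_mkcond /=; apply: eq_bigr => x _.
by rewrite inE; case: (x \in A); case: (P x).
Qed.

Lemma sum_bool_le (P : pred T) (A : {set T}) : \sum_(x in A) (P x : nat) <= #|A|.
Proof. by rewrite sum_card; apply/subset_leq_card/subsetP => x /[!inE] /andP[]. Qed.

(** One round of Furedi's argument.  Up to the exceptional set X, the vertex x has
    maximum degree in W; its non-neighbors form a new color class, and the
    coloring of its neighborhood W' is kept.  A vertex y of the new class has at
    most #|W'| neighbors in W :\: X, so it has at most as many neighbors inside the new
    class as non-neighbors in W'.  Thus each monochromatic pair that is created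
    is paid for by a missing pair between the new class and W', and the latter
    are counted in both orders, whence the factor 2. *)
Lemma furedi_step (W X : {set T}) (x : T) (col : T -> nat)
    (W' := (W :\: X) :&: nbr x)
    (col' := fun y => if y \in W' then (col y).+1 else 0) :
    X \subset W ->
    {in W :\: X, forall y, #|(W :\: X) :&: nbr y| <= #|(W :\: X) :&: nbr x|} ->
  2 * mono col' W W + miss col W' W'
    <= miss col' W W + 2 * mono col W' W' + 4 * (#|X| * #|T|).
Proof.
move=> sXW xmax.
pose A := (W :\: X) :\: nbr x.
have splitW (F : T -> nat) : \sum_(y in W) F y =
    \sum_(y in W') F y + (\sum_(y in A) F y + \sum_(y in X) F y).
  rewrite (big_setID X) /= (setIidPr sXW) addnC addnA; congr (_ + _).
  by rewrite (big_setID (nbr x)).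
have cW' y : y \in W' -> col' y = (col y).+1 by rewrite /col' => ->.
have cA y : y \in A -> col' y = 0.
  by rewrite /col' !inE => /andP[/negbTE ->]; rewrite andbF.
have cX y : y \in X -> col' y = 0.
  by rewrite /col' !inE => ->.
(* The missing pairs between the new class and W' that pay for the edges inside
   the new class. *)
pose N := \sum_(y in A) \sum_(z in W') (~~ G y z : nat).
have monoW : mono col' W W <= mono col W' W' + (2 * (#|X| * #|T|) + N).
  rewrite /mono splitW; apply: leq_add.
    apply: leq_sum => y yW'; rewrite splitW.
    rewrite [X in _ + (X + _)]big1 => [|z zA]; last by rewrite (cW' y) // cA // andbF.
    rewrite [X in _ + (_ + X)]big1 => [|z zA]; last by rewrite (cW' y) // cX // andbF.
    rewrite !addn0; apply: leq_sum => z zW'.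
    by rewrite !cW'.
  have hA y : y \in A ->
      \sum_(z in W) (G y z && (col' y == col' z))
        <= #|X| + \sum_(z in W') (~~ G y z : nat).
    move=> yA; rewrite splitW big1 => [|z zW']; last by rewrite cA // cW' // andbF.
    rewrite add0n addnC; apply: leq_add; first exact: sum_bool_le.
    apply: (@leq_trans (\sum_(z in A) (G y z : nat))).
      by apply: leq_sum => z zA; rewrite (cA y) // cA // andbT.
    have yWX : y \in W :\: X by move: yA; rewrite inE => /andP[].
    have := xmax y yWX.
    have -> : #|(W :\: X) :&: nbr y| =
      \sum_(z in W') (G y z : nat) + \sum_(z in A) (G y z : nat).
      rewrite -[LHS]sum1_card (big_setID (nbr x)) /=; congr (_ + _).
        rewrite big_mkcond [RHS]big_mkcond; apply: eq_bigr => z _ /=.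
        rewrite !inE; case: (G y z); case: (G x z); case: (z \in W); case: (z \in X) => //.
      rewrite big_mkcond [RHS]big_mkcond; apply: eq_bigr => z _ /=.
      by rewrite !inE; case: (G y z); case: (G x z); case: (z \in W); case: (z \in X).
    rewrite -/W'.
    have -> : #|W'| = \sum_(z in W') (G y z : nat) + \sum_(z in W') (~~ G y z : nat).
      rewrite -big_split /= -sum1_card; apply: eq_bigr => z _; by case: (G y z).
    by rewrite leq_add2l.
  have hX y : y \in X ->
      \sum_(z in W) (G y z && (col' y == col' z)) <= #|T|.
    by move=> _; apply: leq_trans (sum_bool_le _ _) (max_card _).
  apply: (@leq_trans (\sum_(y in A) (#|X| + \sum_(z in W') (~~ G y z : nat))
                      + \sum_(y in X) #|T|)).
    by apply: leq_add; apply: leq_sum.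
  rewrite big_split /= !sum_nat_const -/N.
  have : #|A| * #|X| <= #|X| * #|T| by rewrite mulnC leq_mul2l max_card orbT.
  move: (_ * #|X|) (_ * #|T|) N => a b c; lia.
have missW : miss col W' W' + 2 * N <= miss col' W W.
  rewrite {2}/miss splitW.
  apply: (@leq_trans (\sum_(y in W') (\sum_(z in W') (~~ G y z && (col y != col z))
     + \sum_(z in A) (~~ G y z : nat)) + \sum_(y in A) \sum_(z in W') (~~ G y z : nat))).
    rewrite big_split /= -/N /miss -addnA leq_add2l.
    rewrite exchange_big /= -/N; rewrite (_ : \sum_(y in A) \sum_(z in W') (~~ G z y : nat) = N).
      by rewrite mul2n addnn.
    by apply: eq_bigr => y _; apply: eq_bigr => z _; rewrite adj_sym.
  apply: leq_add.
    apply: leq_sum => y yW'; rewrite splitW; apply: leq_add.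
      by apply: leq_sum => z zW'; rewrite !cW'.
    apply: leq_trans (leq_addr _ _).
    by apply: leq_sum => z zA; rewrite cW' // cA // andbT.
  apply: leq_trans (leq_addr _ _).
  apply: leq_sum => y yA; rewrite splitW; apply: leq_trans (leq_addr _ _).
  by apply: leq_sum => z zW'; rewrite cA // cW' // andbT.
lia.
Qed.

Lemma ordered_cliques_mono j (A B : {set T}) :
  A \subset B -> ordered_cliques j A <= ordered_cliques j B.
Proof.
elim: j A B => [//|j IH] A B sAB /=.
rewrite [X in _ <= X](big_setID A) /= (setIidPr sAB).
apply: leq_trans (leq_addr _ _); apply: leq_sum => x _.
by apply/IH/setSI.
Qed.

Lemma mono_le_ordered_cliques (C : eqType) (col : T -> C) (W : {set T}) :
  mono col W W <= ordered_cliques 2 W.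
Proof.
rewrite /mono /=; apply: leq_sum => x _; rewrite sum1_card sum_card.
by apply/subset_leq_card/subsetP => y; rewrite !inE => /and3P[-> ->].
Qed.

(** Iterating [furedi_step].  The exceptional vertices are those that lie in more
    than K times their fair share of cliques; there are at most #|T| / K of them,
    and all others have a neighborhood to which induction applies, with a clique
    bound that is worse by the factor K.  Here 1 / (K^j P) is the density of
    (j+2)-cliques at the start, so that it is still 1 / P when pairs are
    reached, and the error divided by K P is 2/P + 4j/K. *)
Lemma furedi (K P j : nat) (W : {set T}) : 0 < K ->
    ordered_cliques j.+2 W * (K ^ j * P) <= #|T| ^ j.+2 ->
  exists2 col : T -> nat, (forall x, col x < j.+1) &
    K * P * (2 * mono col W W) <=
      K * P * miss col W W + (2 * K + 4 * (j * P)) * #|T| ^ 2.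
Proof.
move=> K0; elim: j W => [|j IH] W hW.
  exists (fun _ => 0) => //.
  have := mono_le_ordered_cliques (fun _ => 0) W.
  move: hW; rewrite expn0 mul1n => h1 h2.
  have h3 : mono (fun _ => 0) W W * P <= #|T| ^ 2.
    by apply: leq_trans h1; rewrite leq_mul2r h2 orbT.
  move: h3; move: (_ ^ 2) => t; move: (mono _ W W) => I; nia.
pose bad x := #|T| ^ j.+2 < ordered_cliques j.+2 (W :&: nbr x) * (K ^ j * P).
pose X := [set x in W | bad x].
have sXW : X \subset W by apply/subsetP => x; rewrite inE => /andP[].
have [T0|T0] := posnP #|T|.
  have W0 : W = set0.
    by apply/eqP; rewrite -cards_eq0 -leqn0 -T0 max_card.
  by exists (fun _ => 0) => //; rewrite W0 /mono big_set0 !muln0.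
have cX : #|X| * K <= #|T|.
  have t0 : 0 < #|T| ^ j.+2 by rewrite expn_gt0 T0.
  rewrite -(leq_pmul2r t0) -expnS; apply: leq_trans hW.
  rewrite (_ : #|X| * K * _ = \sum_(i in X) #|T| ^ j.+2 * K); last first.
    by rewrite sum_nat_const; ring.
  rewrite [ordered_cliques _ _]/= big_distrl /= [X in _ <= X](big_setID X) /= (setIidPr sXW).
  apply: leq_trans (leq_addr _ _); apply: leq_sum => x; rewrite inE => /andP[_ /ltnW].
  rewrite /bad -(leq_pmul2r K0) => /leq_trans; apply.
  by rewrite expnS /=; apply/eq_leq; ring.
have step0 : 4 * (#|X| * #|T|) * (K * P) <= 4 * P * #|T| ^ 2.
  have : #|X| * K * #|T| * (4 * P) <= #|T| * #|T| * (4 * P) by rewrite !leq_mul.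
  by rewrite expnS expn1; move: #|X| #|T| => a b; nia.
have [W0|/set0Pn[x0 x0W]] := eqVneq (W :\: X) set0.
  exists (fun _ => 0) => //.
  have WX : W = X.
    by apply/eqP; rewrite eqEsubset sXW andbT -setD_eq0 W0.
  have : mono (fun _ => 0) W W <= #|X| * #|T|.
    rewrite /mono -WX -sum_nat_const; apply: leq_sum => x _.
    by apply: leq_trans (sum_bool_le _ _) (max_card _).
  move: step0; move: (_ ^ 2) (mono _ _ _) (#|X| * _) => t I y h1 h2.
  apply: (@leq_trans (4 * P * t)).
    by apply: leq_trans h1; move: (leq_mul (leqnn (K * P)) h2); lia.
  rewrite (_ : 4 * (j.+1 * P) = 4 * P + 4 * (j * P)); last by ring.
  by rewrite !mulnDl; move: (_ * t) (_ * t) (_ * t) (_ * miss _ _ _) => a b c e; lia.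
have [x xW xmax] := @arg_maxnP T x0 (fun y => y \in W :\: X)
  (fun y => #|(W :\: X) :&: nbr y|) x0W.
pose W' := (W :\: X) :&: nbr x.
have [|col colj hcol] := IH W'.
  apply: (@leq_trans (ordered_cliques j.+2 (W :&: nbr x) * (K ^ j * P))).
    by rewrite leq_mul2r ordered_cliques_mono ?orbT // setSI // subsetDl.
  move: xW; rewrite !inE => /andP[/nandP[|] h xW]; first by rewrite xW in h.
  by rewrite /bad -leqNgt in h.
exists (fun y => if y \in W' then (col y).+1 else 0).
  by move=> y; case: ifP => // _; rewrite ltnS.
have := @furedi_step W X x col sXW xmax; rewrite /= -/W'.
move: step0 hcol; move: (mono _ _ _) (mono _ _ _) (miss _ _ _) (miss _ _ _) (_ ^ 2) (#|X| * _).
move=> a b c d t y h1 h2 h3.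
have {}h3 : K * P * (2 * a + d) <= K * P * (c + 2 * b + 4 * y) by rewrite leq_mul2l h3 orbT.
apply: (@leq_trans (K * P * c + (2 * K + 4 * (j * P)) * t + 4 * P * t)); last first.
  rewrite -addnA leq_add2l (_ : 4 * (j.+1 * P) = 4 * P + 4 * (j * P)); last by ring.
  by rewrite !mulnDl; move: (_ * t) (_ * t) (_ * t) => p q u; lia.
move: h1 h2 h3; rewrite [4 * y * _]mulnC !mulnDr; set u := K * P.
move: (_ * t) (_ * t) (u * _) (u * _) (u * _) (u * _) (u * _) => *; lia.
Qed.

End Counting.

(** * Joints *)

Section Joints.

Variables (T : finType) (G : graph T).

Definition is_clique (K : {set T}) : bool :=
  [forall x in K, forall y in K, (x != y) ==> G x y].

Lemma is_cliqueP K : reflect (clique G K) (is_clique K).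
Proof.
apply: (iffP forall_inP) => [h x y xK yK|h x xK].
  by move/forall_inP: (h x xK) => /(_ y yK)/implyP.
by apply/forall_inP => y yK; apply/implyP/h.
Qed.

Definition joint (k : nat) (x y : T) : {set {set T}} :=
  [set K | [&& is_clique K, #|K| == k, x \in K & y \in K]].

Definition cliques_in (j : nat) (W : {set T}) : {set {set T}} :=
  [set K | [&& is_clique K, #|K| == j & K \subset W]].

Lemma cliqueU1 x K : is_clique K -> K \subset nbr G x -> is_clique (x |: K).
Proof.
move=> /is_cliqueP cK /subsetP sK; apply/is_cliqueP => a b.
rewrite !inE => /orP[/eqP->|aK] /orP[/eqP->|bK].
- by rewrite eqxx.
- by move=> _; have := sK b bK; rewrite inE.
- by move=> _; have := sK a aK; rewrite inE adj_sym.
- exact: cK.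
Qed.

Lemma nbr_irr x : x \notin nbr G x.
Proof. by rewrite inE adj_irr. Qed.

(** Adding x to a clique inside its neighborhood is injective. *)
Lemma leq_card_cliquesU1 x j (W : {set T}) (S : {set {set T}}) :
    (forall K, is_clique (x |: K) -> #|x |: K| = j.+1 -> K \subset W :&: nbr G x ->
       x |: K \in S) ->
  #|cliques_in j (W :&: nbr G x)| <= #|S|.
Proof.
move=> hS.
have hx K : K \in cliques_in j (W :&: nbr G x) -> x \notin K.
  rewrite inE subsetI => /and4P[_ _ _ /subsetP sK].
  by apply/negP => /sK; apply/negP/nbr_irr.
have inj : {in cliques_in j (W :&: nbr G x) &, injective (fun K => x |: K)}.
  by move=> K K' /hx xK /hx xK' /= e; rewrite -(setU1K xK) e setU1K.
rewrite -(card_in_imset inj); apply/subset_leq_card/subsetP => _ /imsetP[K hK ->].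
move: (hK); rewrite inE => /and3P[cK /eqP nK sK]; apply: hS => //.
  by apply: cliqueU1 => //; move: sK; rewrite subsetI => /andP[].
by rewrite cardsU1 hx // nK.
Qed.

Lemma ordered_cliques_le j (W : {set T}) :
  ordered_cliques G j W <= j`! * #|cliques_in j W|.
Proof.
elim: j W => [|j IH] W /=.
  rewrite fact0 mul1n; apply/card_gt0P; exists set0.
  rewrite inE cards0 eqxx sub0set !andbT.
  by apply/is_cliqueP => x y; rewrite inE.
apply: (@leq_trans (\sum_(x in W) j`! * #|[set K in cliques_in j.+1 W | x \in K]|)).
  apply: leq_sum => x xW; apply: leq_trans (IH _) _; rewrite leq_mul2l.
  rewrite (leq_card_cliquesU1 (S := [set K in cliques_in j.+1 W | x \in K])) ?orbT //.
  move=> K cK nK; rewrite subsetI => /andP[sKW _].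
  by rewrite !inE cK nK eqxx eqxx subUset sub1set xW sKW.
rewrite -big_distrr /= factS [_.+1 * _]mulnC -mulnA leq_mul2l; apply/orP; right.
rewrite (eq_bigr (fun x => \sum_(K in cliques_in j.+1 W) (x \in K))); last first.
  move=> x _; rewrite -sum1_card big_mkcond [RHS]big_mkcond /=.
  by apply: eq_bigr => K _; rewrite [in LHS]inE; case: (K \in _); case: (x \in K).
rewrite exchange_big /= mulnC -sum_nat_const; apply: leq_sum => K.
rewrite inE => /and3P[_ /eqP <- _].
rewrite sum_card; apply/subset_leq_card/subsetP => x.
by rewrite inE => /andP[].
Qed.

(** Small joints bound the ordered cliques in common neighborhoods; this is how
    the hypothesis on joints enters the stability argument. *)
Lemma ordered_cliques_joint j x y : G x y ->
  ordered_cliques G j (nbr G x :&: nbr G y) <= j`! * #|joint j.+2 x y|.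
Proof.
move=> xy; apply: leq_trans (ordered_cliques_le _ _) _; rewrite leq_mul2l.
apply/orP; right.
apply: (@leq_trans #|[set K in cliques_in j.+1 (nbr G x) | y \in K]|).
  apply: (@leq_card_cliquesU1 y j (nbr G x)) => K cK nK; rewrite subsetI => /andP[sK _].
  by rewrite !inE cK nK !eqxx subUset sub1set inE xy sK.
have inj : {in [set K in cliques_in j.+1 (nbr G x) | y \in K] &,
   injective (fun K => x |: K)}.
  have hx K : K \in [set K in cliques_in j.+1 (nbr G x) | y \in K] -> x \notin K.
    rewrite !inE => /andP[/and3P[_ _ /subsetP sK] _].
    by apply/negP => /sK; apply/negP/nbr_irr.
  by move=> K K' /hx xK /hx xK' /= e; rewrite -(setU1K xK) e setU1K.
rewrite -(card_in_imset inj); apply/subset_leq_card/subsetP => _ /imsetP[K hK ->].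
move: hK; rewrite !inE => /andP[/and3P[cK /eqP nK sK] yK].
rewrite cliqueU1 // eqxx yK orbT !andbT cardsU1 nK.
by rewrite (contra (subsetP sK x) (nbr_irr x)) /= !add1n eqxx.
Qed.

End Joints.

(** * Transversals avoiding missing pairs *)

Section Transversals.

Variables (T : finType) (I : finType).

Lemma card_family_prod (D : I -> {set T}) :
  #|family (fun t => mem (D t))| = \prod_t #|D t|.
Proof.
rewrite card_family foldrE big_map -big_enum /=; exact: eq_bigr.
Qed.

(** A choice function f for D takes a given pair of values at t and t' with
    frequency 1 / (#|D t| * #|D t'|).  This is stated without division, so that
    empty sets need no separate treatment. *)
Lemma card_family_pair (D : I -> {set T}) (t t' : I) (R : rel T) : t != t' ->
  #|[set f : {ffun I -> T} in family (fun t => mem (D t)) | R (f t) (f t')]| * (#|D t| * #|D t'|)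
   = \sum_(x in D t) \sum_(y in D t') (R x y : nat) * \prod_u #|D u|.
Proof.
move=> tt'.
pose E x y u := if u == t then [set x] else if u == t' then [set y] else D u.
have split_prod (F : I -> nat) : \prod_u F u = F t * (F t' * \prod_(u | (u != t) && (u != t')) F u).
  by rewrite (bigD1 t) //= (bigD1 t') //= eq_sym.
rewrite -sum1_card big_mkcond /=.
have -> : \sum_(f : {ffun I -> T})
    (if f \in [set f in family (fun t => mem (D t)) | R (f t) (f t')] then 1 else 0)
  = \sum_(x in D t) \sum_(y in D t') \sum_(f in family (fun t => mem (E x y t))) (R x y : nat).
  rewrite pair_big /=.
  rewrite (eq_bigr (fun p => \sum_(f : {ffun I -> T})
    (if f \in family (fun t => mem (E p.1 p.2 t)) then (R p.1 p.2 : nat) else 0))); last first.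
    by move=> p _; rewrite big_mkcond.
  rewrite exchange_big /=; apply: eq_bigr => f _.
  have [hf|hf] := boolP (f \in family (fun t => mem (D t))); last first.
    rewrite inE (negbTE hf) /= big1 // => p /andP[p1 p2]; case: ifP => // /familyP hE.
    case/negP: hf; apply/familyP => u; have := hE u; rewrite /E.
    case: eqP => [->|_]; first by rewrite !inE => /eqP ->.
    by case: eqP => [->|_]; first by rewrite !inE => /eqP ->.
  have hf' := hf; move/familyP: hf' => hf'.
  rewrite inE hf /= (bigD1 (f t, f t')) /=; last by rewrite hf' hf'.
  rewrite big1 ?addn0.
    rewrite [RHS]ifT; first by case: (R _ _).
    apply/familyP => u; rewrite /E; case: eqP => [->|_]; first by rewrite !inE.
    by case: eqP => [->|_]; rewrite ?inE // hf'.
  move=> [x y] /= /andP[/andP[xD yD] ne]; case: ifP => // /familyP hE.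
  case/negP: ne; have := hE t; have := hE t'; rewrite /E eqxx eq_sym (negbTE tt') eqxx !inE.
  by move=> /eqP -> /eqP ->.
rewrite big_distrl /=; apply: eq_bigr => x xD.
rewrite big_distrl /=; apply: eq_bigr => y yD.
rewrite sum_nat_const (card_family_prod (E x y)) [in RHS]split_prod split_prod.
rewrite {1 2}/E eqxx eq_sym (negbTE tt') eqxx !cards1 !mul1n.
rewrite (eq_bigr (fun u => #|D u|)); first by move: (\prod_(_ | _) _) => q; ring.
by move=> u /andP[/negbTE h1 /negbTE h2]; rewrite /E h1 h2.
Qed.

End Transversals.

Section RichJoint.

Variables (T : finType) (G : graph T) (C : finType) (col : T -> C).
Variable d : nat.

(** The configurations that force a large joint: sets D t of neighbors of v, one
    for each color, of size at least d and correctly colored.  At the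
    distinguished color s there is an alternative: D s may be small and colored
    in any way, provided that it is completely joined to the other sets.  The
    alternative serves for a single edge v w with many common neighbors, where
    D s is the singleton of w. *)
Definition rich (v : T) (s : C) (D : C -> {set T}) : Prop :=
  [/\ forall t x, x \in D t -> G v x,
      forall t x, t != s -> x \in D t -> col x = t,
      forall t, t != s -> d <= #|D t|
    & ((forall x, x \in D s -> col x = s) /\ d <= #|D s|) \/
      (forall t x y, t != s -> x \in D s -> y \in D t -> G x y)].

Variables (v : T) (s : C) (D : C -> {set T}).

Hypothesis richD : rich v s D.

Let adjD : forall t x, x \in D t -> G v x.
Proof. by case: richD. Qed.

Let colD : forall t x, t != s -> x \in D t -> col x = t.
Proof. by case: richD. Qed.

Let cardD : forall t, t != s -> d <= #|D t|.
Proof. by case: richD. Qed.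

Let Ds : ((forall x, x \in D s -> col x = s) /\ d <= #|D s|) \/
  (forall t x y, t != s -> x \in D s -> y \in D t -> G x y).
Proof. by case: richD. Qed.

Hypothesis missd : miss G col setT setT <= d ^ 2.
Hypothesis d0 : 0 < d.

Let fam := [set f : {ffun C -> T} in family (fun t => mem (D t))].
Let good := [set f in fam | [forall t, forall t', (t != t') ==> G (f t) (f t')]].

Let missing t t' x y : bool := [&& t != t', x \in D t, y \in D t' & ~~ G x y].

(** If D s is small or wrongly colored, then it is completely joined to the other
    sets and contributes no missing pair. *)
Lemma missing_col t t' x y : missing t t' x y -> t = col x /\ t' = col y.
Proof.
rewrite /missing => /and4P[tt' xD yD nxy].
have [[cs _]|adjDs] := Ds.
  have c u z : z \in D u -> u = col z.
    by case: (eqVneq u s) => [-> /cs //|us /(colD us)].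
  by rewrite -(c t x) // -(c t' y).
case: (eqVneq t s) => [ts|ts].
  by rewrite (adjDs t' x y) -?ts // eq_sym in nxy.
case: (eqVneq t' s) => [ts'|ts'].
  by rewrite adj_sym (adjDs t y x) -?ts' // in nxy.
by rewrite (colD ts xD) (colD ts' yD).
Qed.

Lemma disjointD t t' x : x \in D t -> x \in D t' -> t = t'.
Proof.
move=> xt xt'; apply/eqP; apply: contraT => tt'.
have h : missing t t' x x by rewrite /missing tt' xt xt' adj_irr.
by have [e1 e2] := missing_col h; rewrite e1 -e2 eqxx in tt'.
Qed.

Lemma sum_missing_le : \sum_t \sum_t' \sum_x \sum_y missing t t' x y <= d ^ 2.
Proof.
apply: leq_trans missd; rewrite /miss.
under eq_bigr => t _ do rewrite exchange_big /=.
rewrite exchange_big /= [X in _ <= X]big_mkcond /=; apply: leq_sum => x _; rewrite inE.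
under eq_bigr => t _ do rewrite exchange_big /=.
rewrite exchange_big /= [X in _ <= X]big_mkcond /=; apply: leq_sum => y _; rewrite inE.
rewrite (bigD1 (col x)) //= (bigD1 (col y)) //=.
have z t t' : (t != col x) || (t' != col y) -> (missing t t' x y : nat) = 0.
  move=> h; case e : (missing t t' x y) => //.
  by have [e1 e2] := missing_col e; rewrite e1 e2 !eqxx in h.
rewrite big1 ?addn0; last by move=> t' h; apply: z; rewrite h orbT.
rewrite [X in _ + X]big1 ?addn0; last by move=> t h; rewrite big1 // => t' _; apply: z; rewrite h.
by rewrite /missing; case: (_ != _); case: (_ \in _); case: (_ \in _); case: (G x y).
Qed.

Lemma card_fam : #|fam| = \prod_t #|D t|.
Proof. by rewrite -card_family_prod; apply: eq_card => f; rewrite inE. Qed.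

(** The set D t is large unless t = s and D s is completely joined to the rest, in
    which case the left-hand side vanishes. *)
Lemma bad_pair t t' : t != t' ->
  #|[set f in fam | ~~ G (f t) (f t')]| * d ^ 2
    <= (\sum_x \sum_y missing t t' x y) * #|fam|.
Proof.
move=> tt'.
have hfam f : f \in fam -> forall u, f u \in D u by rewrite inE => /familyP.
case: (boolP ((d <= #|D t|) && (d <= #|D t'|))) => [/andP[dt dt']|hd].
  apply: (@leq_trans (#|[set f in fam | ~~ G (f t) (f t')]| * (#|D t| * #|D t'|))).
    by rewrite leq_mul2l expnS expn1 leq_mul ?orbT.
  have /= := @card_family_pair T C D t t' (fun x y => ~~ G x y) tt'.
  rewrite (eq_card (B := [set f in fam | ~~ G (f t) (f t')])); last first.
    by move=> f; rewrite !inE.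
  move=> ->; rewrite card_fam; apply: eq_leq.
  rewrite big_distrl /= big_mkcond /=; apply: eq_bigr => x _.
  case: ifP => xD; last first.
    by rewrite big1 // => y _; rewrite /missing xD /= andbF.
  rewrite -big_distrl /=; congr (_ * _); rewrite big_mkcond /=.
  by apply: eq_bigr => y _; rewrite /missing tt' xD /=; case: (y \in _); case: (G x y).
rewrite (_ : [set _ in _ | _] = set0) ?cards0 //.
apply/setP => f; rewrite inE in_set0; apply/negbTE; apply/negP => /andP[/hfam hf nG].
have h : missing t t' (f t) (f t') by rewrite /missing tt' !hf.
case/negP: hd; have [[_ ds]|adjDs] := Ds.
  by apply/andP; split; [case: (eqVneq t s) => [->|/cardD] | case: (eqVneq t' s) => [->|/cardD]].
have ts : t != s.
  apply: contraNneq nG => ts; apply: (adjDs t'); rewrite -?ts // eq_sym //.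
have ts' : t' != s.
  apply: contraNneq nG => ts'; rewrite adj_sym; apply: (adjDs t); rewrite -?ts' //.
by rewrite !cardD.
Qed.

(** Union bound: a transversal that is not a clique contains a missing pair, in
    both orders, and a given missing pair lies in at most a d^-2 fraction of all
    transversals.  Since there are at most d^2 missing pairs, counted in both
    orders, at most half of the transversals are spoiled. *)
Lemma good_many : #|fam| <= 2 * #|good|.
Proof.
have bad2 : 2 * #|fam :\: good| <=
    \sum_t \sum_(t' | t != t') #|[set f in fam | ~~ G (f t) (f t')]|.
  under eq_bigr => t _ do under eq_bigr => t' _ do
    rewrite -sum1_card big_mkcond /=.
  under eq_bigr => t _ do rewrite exchange_big /=.
  rewrite exchange_big /= mulnC -sum_nat_const big_mkcond /=.
  apply: leq_sum => f _; case: ifP => //; rewrite in_setD => /andP[+ ffam].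
  rewrite inE ffam /= => /forallPn[t /forallPn[t']]; rewrite negb_imply => /andP[tt' nG].
  rewrite (bigD1 t) //= (bigD1 t') //= inE ffam nG.
  rewrite [X in _ + _ + X](bigD1 t') /=; last by rewrite eq_sym.
  rewrite [X in _ + (X + _)](bigD1 t) /=; last by rewrite eq_sym.
  by rewrite inE ffam adj_sym nG /=; lia.
have bad2' : 2 * #|fam :\: good| * d ^ 2 <= d ^ 2 * #|fam|.
  apply: (@leq_trans (\sum_t \sum_(t' | t != t')
    ((\sum_x \sum_y missing t t' x y) * #|fam|))).
    apply: leq_trans (leq_mul bad2 (leqnn _)) _.
    rewrite big_distrl /=; apply: leq_sum => t _; rewrite big_distrl /=.
    by apply: leq_sum => t' tt'; apply: bad_pair.
  under eq_bigr => t _ do rewrite -big_distrl /=.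
  rewrite -big_distrl /= leq_mul2r; apply/orP; right.
  apply: leq_trans sum_missing_le; apply: leq_sum => t _; rewrite big_mkcond /=.
  by apply: leq_sum => t' _; case: ifP.
have : 2 * #|fam :\: good| <= #|fam|.
  by rewrite -(@leq_pmul2r (d ^ 2)) ?expn_gt0 ?d0 // [X in _ <= X]mulnC.
have := cardsID good fam; rewrite (setIidPr _); first lia.
by apply/subsetP => f; rewrite inE => /andP[].
Qed.

(** The transversal can be recovered from its image, because the sets D t are
    disjoint and v lies in none of them. *)
Lemma good_joint w : #|[set f in good | f s == w]| <= #|joint G #|C|.+1 v w|.
Proof.
pose h (f : {ffun C -> T}) := v |: f @: setT.
have hgood f : f \in good -> (forall u, f u \in D u) /\ (forall t t', t != t' -> G (f t) (f t')).
  rewrite !inE => /andP[/familyP h1 /forallP h2]; split => // t t' tt'.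
  by move/forallP: (h2 t) => /(_ t')/implyP/(_ tt').
have inj : {in [set f in good | f s == w] &, injective h}.
  move=> f f'; rewrite inE => /andP[/hgood[fD _] _].
  rewrite inE => /andP[/hgood[fD' _] _] e.
  apply/ffunP => t.
  have : f t \in h f' by rewrite -e /h inE imset_f ?orbT.
  rewrite !inE => /orP[/eqP ev|/imsetP[t' _ et]].
    by have := adjD (fD t); rewrite ev adj_irr.
  have tt' : t = t' by apply: (disjointD (fD t)); rewrite et.
  by rewrite et tt'.
rewrite -(card_in_imset inj); apply/subset_leq_card/subsetP => _ /imsetP[f hf ->].
move: hf; rewrite inE => /andP[/hgood[fD fG] /eqP fs].
have finj : injective f by move=> t t' e; apply: (disjointD (fD t)); rewrite e.
have adjv x : x \in f @: setT -> G v x by move=> /imsetP[t _ ->]; apply: adjD (fD t).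
have nv : v \notin f @: setT by apply/negP => /adjv; rewrite adj_irr.
rewrite inE; apply/and4P; split; last by rewrite /h inE -fs imset_f ?orbT.
- apply: cliqueU1; last by apply/subsetP => x /adjv; rewrite inE.
  apply/is_cliqueP => _ _ /imsetP[t _ ->] /imsetP[t' _ ->] ne; apply: fG.
  by apply: contraNneq ne => ->.
- by rewrite cardsU1 nv card_imset // cardsT.
- by rewrite setU11.
Qed.

(** At least half of the transversals are cliques; averaging over their values at
    s gives one w through which many of them pass. *)
Lemma rich_joint : D s != set0 ->
  exists2 w, w \in D s & d ^ #|C|.-1 <= 2 * #|joint G #|C|.+1 v w|.
Proof.
move=> Ds0.
have prodD : #|D s| * d ^ #|C|.-1 <= #|fam|.
  rewrite card_fam (bigD1 s) //= leq_mul2l; apply/orP; right.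
  have -> : #|C|.-1 = #|[set t | t != s]|.
    rewrite (_ : [set t | t != s] = [set~ s]) ?cardsC1 //.
    by apply/setP => t; rewrite !inE.
  rewrite -prod_nat_const big_mkcond [X in _ <= X]big_mkcond /=; apply: leq_prod => t _.
  by rewrite inE; case: ifP => // /cardD.
have goodE : #|good| = \sum_(w in D s) #|[set f in good | f s == w]|.
  rewrite -sum1_card (partition_big (fun f : {ffun C -> T} => f s) (mem (D s))) /=.
    by apply: eq_bigr => w _; rewrite -sum1_card; apply: eq_bigl => f; rewrite [in RHS]inE.
  by move=> f; rewrite !inE => /andP[/familyP hf _]; apply: hf.
have [w wD hw] : exists2 w, w \in D s & d ^ #|C|.-1 <= 2 * #|[set f in good | f s == w]|.
  apply/exists_inP; apply: contraT => /exists_inPn h.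
  have : 2 * #|good| < #|D s| * d ^ #|C|.-1.
    rewrite goodE big_distrr /= -sum_nat_const.
    have [w0 w0D] := set0Pn _ Ds0.
    rewrite (bigD1 w0) //= [X in _ < X](bigD1 w0) //=.
    rewrite -addSn; apply: leq_add; first by rewrite ltnNge h.
    by apply: leq_sum => w /andP[wD _]; rewrite ltnW // ltnNge h.
  by have := good_many; move: prodD; lia.
by exists w => //; apply: leq_trans hw _; rewrite leq_mul2l good_joint orbT.
Qed.

End RichJoint.

(** * Chebyshev's sum inequality *)

Section Chebyshev.

Variable r : nat.

(** Two sequences that are sorted by the same permutation are similarly ordered,
    which is the hypothesis of Chebyshev's inequality. *)
Definition sorted_by (s : 'S_r) (a : 'I_r -> nat) : Prop :=
  forall u v : 'I_r, u <= v -> a (s v) <= a (s u).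

Lemma sorted_by_exists (a : 'I_r -> nat) : exists s : 'S_r, sorted_by s a.
Proof.
pose t := codom_tuple a.
have sz : size (sort geq t) == r by rewrite size_sort size_tuple card_ord.
have /tuple_permP[s hs] : perm_eq (Tuple sz) (map_tuple a (ord_tuple r)).
  by rewrite /= perm_sort /t /= codomE.
exists s => u v uv.
have tn w : tnth (Tuple sz) w = a (s w).
  rewrite (tnth_nth 0) hs /= (nth_map w) ?size_enum_ord //.
  by rewrite nth_ord_enum tnth_map tnth_ord_tuple.
rewrite -!tn !(tnth_nth 0) /=.
have tr : transitive geq by move=> x y z h1 h2; apply: leq_trans h2 h1.
have to : total geq by move=> x y; rewrite /geq leq_total.
apply: (sorted_leq_nth tr _ 0 (sort_sorted to _)) => //.
- by move=> x; rewrite /geq /=.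
- by rewrite inE (eqP sz).
- by rewrite inE (eqP sz).
Qed.

(* Chebyshev's inequality is the sum over u and v of
   0 <= (a u - a v) * (b u - b v), here with all terms kept positive. *)
Let cross (a b : 'I_r -> nat) s t := a s * b t + a t * b s.
Let diag (a b : 'I_r -> nat) s t := a s * b s + a t * b t.

Lemma cross_le_diag (s : 'S_r) a b u v :
  sorted_by s a -> sorted_by s b -> cross a b u v <= diag a b u v.
Proof.
move=> sa sb; rewrite -(permKV s u) -(permKV s v).
move: (s^-1 u)%g (s^-1 v)%g => {u v} u v; rewrite /cross /diag.
have [uv|/ltnW uv] := leqP u v; have h1 := sa _ _ uv; have h2 := sb _ _ uv; nia.
Qed.

Lemma sum_diag a b : \sum_u \sum_v diag a b u v = 2 * (r * \sum_s a s * b s).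
Proof.
rewrite /diag; under eq_bigr => u _ do rewrite big_split /= sum_nat_const card_ord.
by rewrite big_split /= sum_nat_const card_ord -big_distrr /=; lia.
Qed.

Lemma sum_cross a b : \sum_u \sum_v cross a b u v = 2 * ((\sum_s a s) * \sum_s b s).
Proof.
rewrite /cross; under eq_bigr => u _ do rewrite big_split /= -big_distrr -big_distrl /=.
by rewrite big_split /= -big_distrl -big_distrr /=; lia.
Qed.

Lemma chebyshev (s : 'S_r) a b : sorted_by s a -> sorted_by s b ->
  (\sum_u a u) * (\sum_u b u) <= r * \sum_u a u * b u.
Proof.
move=> sa sb; rewrite -(@leq_pmul2l 2) // -sum_cross -sum_diag.
by apply: leq_sum => u _; apply: leq_sum => v _; apply: (cross_le_diag (s := s)).
Qed.

Definition uniform (a : 'I_r -> nat) : bool := [forall u, forall v, a u == a v].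

Lemma uniformP a : reflect (forall u v, a u = a v) (uniform a).
Proof.
apply: (iffP forallP) => [h u v|h u]; first by apply/eqP/(forallP (h u)).
by apply/forallP => v; apply/eqP/h.
Qed.

(** Equality forces (a u - a v) * (b u - b v) = 0 for all u and v.  At the two
    ends of the common order this makes a or b constant. *)
Lemma chebyshev_eq (s : 'S_r) a b : sorted_by s a -> sorted_by s b ->
    r * (\sum_u a u * b u) <= (\sum_u a u) * (\sum_u b u) ->
  uniform a || uniform b.
Proof.
move=> sa sb h; have [r0|r0] := posnP r.
  by apply/orP; left; apply/uniformP => -[u ur]; exfalso; move: ur; rewrite r0.
pose first : 'I_r := Ordinal r0.
have lr : r.-1 < r by rewrite prednK.
pose last : 'I_r := Ordinal lr.
have eqcd u v : cross a b u v = diag a b u v.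
  have hle := leq_trans (leq_trans (eq_leq (sum_diag a b)) (leq_mul (leqnn 2) h))
    (eq_leq (esym (sum_cross a b))).
  have h1 u0 v0 : cross a b u0 v0 <= diag a b u0 v0 by apply: (cross_le_diag (s := s)).
  apply/eqP; rewrite eqn_leq h1 /= leqNgt; apply/negP => lt.
  move: hle; rewrite leqNgt => /negP[].
  rewrite (bigD1 u) //= [X in _ < X](bigD1 u) //= -addSn; apply: leq_add; last first.
    by apply: leq_sum => u0 _; apply: leq_sum => v0 _; apply: (cross_le_diag (s := s)).
  rewrite (bigD1 v) //= [X in _ < X](bigD1 v) //= -addSn; apply: leq_add.
    exact: lt.
  by apply: leq_sum => v0 _; apply: (cross_le_diag (s := s)).
have := eqcd (s first) (s last).
have a0 := sa first last (leq0n _); have b0 := sb first last (leq0n _).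
have const (c : 'I_r -> nat) : sorted_by s c -> c (s last) = c (s first) -> uniform c.
  move=> sc e; apply/uniformP.
  suff cc u : c u = c (s first) by move=> u v; rewrite cc (cc v).
  rewrite -(permKV s u); move: (s^-1 u)%g => {}u; apply/eqP.
  by rewrite eqn_leq sc // -{1}e sc //= -ltnS prednK.
rewrite /cross /diag => e.
have [ea|na] := eqVneq (a (s last)) (a (s first)); first by rewrite const.
have [eb|nb] := eqVneq (b (s last)) (b (s first)); first by rewrite (const b) ?orbT.
by exfalso; move: a0 b0 e na nb; clear; nia.
Qed.

End Chebyshev.

(** * Counting pairs, and maximum cuts *)

Section PairCount.

Variables (T : finType) (G : graph T).

Definition edges (A B : {set T}) : nat := \sum_(x in A) \sum_(y in B) (G x y : nat).

Lemma edgesE A B : edges A B = edges_between G A B.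
Proof.
rewrite /edges /edges_between pair_big /= -sum1_card big_mkcond [RHS]big_mkcond /=.
by apply: eq_bigr => -[x y] _; rewrite !inE /=; case: (G x y); case: (_ && _).
Qed.

Variables (C : finType) (col : T -> C).

(** Each pair is an edge, missing, or has equal colors; the pairs counted twice
    are the monochromatic edges. *)
Lemma pair_count (A B : {set T}) :
  edges A B + miss G col A B
   + \sum_s #|[set x in A | col x == s]| * #|[set x in B | col x == s]|
  = #|A| * #|B| + mono G col A B.
Proof.
have -> : \sum_s #|[set x in A | col x == s]| * #|[set x in B | col x == s]|
   = \sum_(x in A) \sum_(y in B) (col x == col y : nat).
  under eq_bigr => s _ do rewrite -!sum_card big_distrl /=.
  rewrite exchange_big /=; apply: eq_bigr => x _.
  under eq_bigr => s _ do rewrite big_distrr /=.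
  rewrite exchange_big /=; apply: eq_bigr => y _.
  rewrite (bigD1 (col x)) //= eqxx mul1n big1 ?addn0; first by rewrite eq_sym.
  by move=> s; rewrite eq_sym => /negbTE ->.
rewrite -sum_nat_const /edges /miss /mono -!big_split /=; apply: eq_bigr => x _.
rewrite -sum1_card -!big_split /=; apply: eq_bigr => y _.
by case: (G x y); case: (col x == col y).
Qed.

End PairCount.

Section MaxCut.

Variables (T : finType) (G : graph T) (C : finType).

Definition color_degree (col : T -> C) (v : T) (s : C) : nat :=
  #|[set y in nbr G v | col y == s]|.

Lemma mono_bigD1 (col : T -> C) v :
  mono G col setT setT = 2 * (\sum_(y | y != v) (G v y && (col v == col y)))
    + \sum_(x | x != v) \sum_(y | y != v) (G x y && (col x == col y)).
Proof.
rewrite /mono; under eq_bigl => x do rewrite inE.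
under eq_bigr => x _ do under eq_bigl => y do rewrite inE.
rewrite (bigD1 v) //= (bigD1 v) //= adj_irr add0n.
under [X in _ + X]eq_bigr => x _ do rewrite (bigD1 v) //= adj_sym eq_sym.
by rewrite big_split /=; lia.
Qed.

(** A coloring with the fewest monochromatic edges.  Recoloring a single vertex
    does not help, so every vertex has at least as many neighbors in any other
    class as in its own. *)
Lemma max_cut_exists (col0 : T -> C) : exists col : T -> C,
  mono G col setT setT <= mono G col0 setT setT /\
  forall v t, color_degree col v (col v) <= color_degree col v t.
Proof.
have [f _ fmin] := @arg_minnP {ffun T -> C} (finfun col0) predT
  (fun f => mono G f setT setT) isT.
exists f; split.
  apply: leq_trans (fmin (finfun col0) isT) _; apply: eq_leq.
  by apply: eq_bigr => x _; apply: eq_bigr => y _; rewrite !ffunE.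
move=> v t; pose f' := [ffun x => if x == v then t else f x].
have := fmin f' isT; rewrite !(mono_bigD1 _ v).
have -> : \sum_(x | x != v) \sum_(y | y != v) (G x y && (f' x == f' y))
        = \sum_(x | x != v) \sum_(y | y != v) (G x y && (f x == f y)).
  apply: eq_bigr => x xv; apply: eq_bigr => y yv.
  by rewrite !ffunE (negbTE xv) (negbTE yv).
rewrite leq_add2r leq_pmul2l //.
have E (c : C) : color_degree f v c = \sum_(y | y != v) (G v y && (c == f y)).
  rewrite /color_degree -sum1_card big_mkcond [RHS]big_mkcond /=; apply: eq_bigr => y _.
  rewrite !inE [c == _]eq_sym; have [->|_] := eqVneq y v; first by rewrite adj_irr.
  by case: (G v y && _).
rewrite !E => h; apply: leq_trans h _; apply: leq_sum => y yv.
by rewrite !ffunE eqxx (negbTE yv).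
Qed.

End MaxCut.

(** * An r-coloring with few monochromatic edges and few missing pairs *)

(** A set of vertices counts as large if it has at least #|T| / (8 r r!) elements.
    Here r! is lost when passing to parts with the same ranking of colors, and
    1 / (8 r) is a fixed fraction of a color class on those parts. *)
Definition threshold_ratio (r : nat) : nat := 8 * r * r`!.

Lemma fact_le_exp r : 0 < r -> r`! <= r ^ r.-1.
Proof.
case: r => // r _ /=; elim: r => // r IH.
rewrite factS expnS leq_mul2l; apply/orP; right; apply: leq_trans IH _.
by case: r => // r; rewrite leq_exp2r.
Qed.

(** Bernoulli's inequality (1 + 1/r)^r >= 2.  This factor 2 is what lets the
    numerical conditions below hold already from r = 2 on. *)
Lemma double_exp_le r : 0 < r -> 2 * r ^ r <= r.+1 ^ r.
Proof.
move=> r0.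
have h j : (r + j) * r ^ j <= r * r.+1 ^ j.
  elim: j => [|j IH]; first by rewrite addn0.
  rewrite !expnS.
  apply: (@leq_trans (r.+1 * ((r + j) * r ^ j))); last by move: IH; move: (_ ^ j) (_ ^ j); nia.
  by rewrite mulnA [X in _ <= X]mulnA leq_mul2r; apply/orP; right; nia.
by move: (h r); rewrite addnn -mul2n -mulnA mulnCA leq_pmul2l.
Qed.

Lemma threshold_ratio_le r : 0 < r -> threshold_ratio r <= 4 * r.+1 ^ r.
Proof.
move=> r0; rewrite /threshold_ratio -mulnA.
have : r * r`! <= r ^ r.
  by rewrite -[X in _ <= r ^ X](prednK r0) expnS leq_mul2l fact_le_exp ?orbT.
by move: (double_exp_le r0); move: (_ ^ r) (_ ^ r) (r * _) => *; lia.
Qed.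

Lemma threshold_ratio_sq r : 0 < r -> threshold_ratio r ^ 2 <= 16 * r.+1 ^ (2 * r).
Proof.
move=> r0; apply: (@leq_trans ((4 * r.+1 ^ r) ^ 2)).
  by rewrite leq_exp2r // threshold_ratio_le.
by rewrite expnMn -expnM mulnC [r * 2]mulnC mulnC.
Qed.

Lemma threshold_ratio_sq8 r e : 2 <= r -> 2 * r + 5 <= e -> 8 * threshold_ratio r ^ 2 <= r.+1 ^ e.
Proof.
move=> r2 he; have r0 : 0 < r by lia.
apply: (@leq_trans (r.+1 ^ (2 * r + 5))); last by rewrite leq_exp2l //; lia.
rewrite expnD mulnC; apply: leq_trans (leq_mul (threshold_ratio_sq r0) (leqnn 8)) _.
rewrite mulnAC mulnC leq_mul2l; apply/orP; right.
by apply: (@leq_trans (3 ^ 5)) => //; rewrite leq_exp2r //; lia.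
Qed.

Lemma threshold_ratio_sq8_sub2 r : 2 <= r ->
  8 * (r - 2) * threshold_ratio r ^ 2 <= r.+1 ^ (2 * r + 5).
Proof.
move=> r2; have r0 : 0 < r by lia.
have [->|r3] := eqVneq r 2; first by rewrite subnn muln0.
apply: leq_trans (leq_mul (leqnn _) (threshold_ratio_sq r0)) _.
rewrite mulnA expnD mulnC leq_mul2l; apply/orP; right.
have h : 128 <= r.+1 ^ 4.
  by apply: (@leq_trans (4 ^ 4)) => //; rewrite leq_exp2r //; lia.
by rewrite (expnS _ 4); move: h; move: (_ ^ 4) => q; nia.
Qed.

(** Estimating (r-1)! by (r+1)^(r-2), the exponents match exactly:
    (2r+5)(r-2) + (2r+14) + (r-2) = 2(r+1)^2. *)
Lemma furedi_constants r : 2 <= r ->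
  (r.+1 ^ (2 * r + 5)) ^ (r - 2) * r.+1 ^ (2 * r + 14) * (r.-1)`! <= r.+1 ^ (2 * r.+1 ^ 2).
Proof.
move=> r2.
have h : (r.-1)`! <= r.+1 ^ (r - 2).
  apply: leq_trans (fact_le_exp _) _; first by lia.
  have -> : r.-1.-1 = r - 2 by lia.
  case: (r - 2) => // q; rewrite leq_exp2r //; lia.
apply: leq_trans (leq_mul (leqnn _) h) _.
rewrite -expnM -!expnD leq_exp2l; last by lia.
by case: r r2 {h} => [|[|r]] // _; rewrite !subn2 /=; nia.
Qed.

(** With d >= #|T| / threshold_ratio r, half of d^(r-1) is at least the size that
    joints are assumed not to reach. *)
Lemma threshold_ratio_joint r : 2 <= r -> 2 * threshold_ratio r ^ r.-1 <= r.+1 ^ (2 * r.+1 ^ 2).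
Proof.
move=> r2; have r0 : 0 < r by lia.
have h : threshold_ratio r <= r.+1 ^ (r + 2).
  apply: leq_trans (threshold_ratio_le r0) _; rewrite expnD mulnC leq_mul2l; apply/orP; right.
  by apply: (@leq_trans (3 ^ 2)) => //; rewrite leq_exp2r //; lia.
apply: (@leq_trans (r.+1 * (r.+1 ^ (r + 2)) ^ r.-1)).
  apply: leq_mul; first by lia.
  by case: r r2 {r0} h => [|[|r]] // _ h; rewrite leq_exp2r.
rewrite -expnM -expnS leq_exp2l; last by lia.
by case: r r2 {r0 h} => [|[|r]] // _; rewrite /=; nia.
Qed.

Lemma threshold_ratio_gt0 r : 0 < r -> 0 < threshold_ratio r.
Proof. by move=> r0; rewrite /threshold_ratio !muln_gt0 r0 fact_gt0. Qed.

Section GoodColoring.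

Variables (T : finType) (G : graph T) (r l m : nat).
Hypothesis r2 : 2 <= r.
Hypothesis hl : r.+1 ^ (12 * r.+1) <= l.
Hypothesis hn : #|T| = l * m.
Hypothesis hE : r.-1 * (l * l.-1 * m ^ 2) <= r * edges G setT setT.
(* With k = r + 1, the joint of the edge x y is smaller than k^(-2k^2) n^(k-2). *)
Hypothesis nojoint : forall x y, G x y ->
  #|joint G r.+1 x y| * r.+1 ^ (2 * r.+1 ^ 2) < #|T| ^ r.-1.

(* The parameters of [furedi].  To keep the errors small, K must be at least
   8 (r - 2) times and P at least 8 times threshold_ratio r ^ 2; on the other
   hand K^(r-2) P (r-1)! must not exceed k^(2k^2). *)
Let K := r.+1 ^ (2 * r + 5).
Let P := r.+1 ^ (2 * r + 14).

Lemma ordered_cliques_nbr x :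
  ordered_cliques G r (nbr G x) * (K ^ (r - 2) * P) <= #|T| ^ r.
Proof.
have f0 : 0 < (r.-1)`! by apply: fact_gt0.
rewrite -(leq_pmul2r f0).
apply: (@leq_trans (ordered_cliques G r (nbr G x) * r.+1 ^ (2 * r.+1 ^ 2))).
  by rewrite -mulnA leq_mul2l furedi_constants ?orbT.
have er : r = r.-1.+1 by lia.
rewrite [X in ordered_cliques G X](er) [ordered_cliques _ _ _]/=.
rewrite [X in #|T| ^ X](er) [#|T| ^ _]expnS -mulnA [_ ^ _ * _`!]mulnC.
apply: (@leq_trans (\sum_(y in nbr G x) (r.-1)`! * #|T| ^ r.-1)); last first.
  by rewrite sum_nat_const leq_mul2r max_card orbT.
rewrite big_distrl /=; apply: leq_sum => y; rewrite inE => xy.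
apply: leq_trans (leq_mul (ordered_cliques_joint _ xy) (leqnn _)) _.
by rewrite -er -mulnA leq_mul2l ltnW ?orbT // nojoint.
Qed.

(** By hypothesis every vertex lies in few cliques.  The first round of Furedi's
    argument thus needs no exceptional set, and [furedi] takes over in the
    neighborhood of a vertex of maximum degree. *)
Lemma coloring_few_mono : exists col : T -> 'I_r,
  K * P * (2 * mono G col setT setT)
    <= K * P * miss G col setT setT + (2 * K + 4 * ((r - 2) * P)) * #|T| ^ 2.
Proof.
have r0 : 0 < r by lia.
have e2 : (r - 2).+2 = r by lia.
case: (pickP (mem [set: T])) => [x0 x0T|noT]; last first.
  have T0 : T -> False by move=> x; have := noT x; rewrite /= inE.
  exists (fun x => False_rect _ (T0 x)).
  rewrite (_ : mono _ _ _ _ = 0) ?muln0 //.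
  by apply: big1 => x; case: (T0 x).
have [x _ xmax] := @arg_maxnP T x0 (fun y => y \in [set: T])
  (fun y => #|nbr G y|) x0T.
have K0 : 0 < K by rewrite expn_gt0.
have [|col colr hcol] := @furedi T G K P (r - 2) (nbr G x) K0.
  by rewrite e2; apply: ordered_cliques_nbr.
have sx : (setT :\: set0) :&: nbr G x = nbr G x by rewrite setD0 setTI.
pose col' y := if y \in nbr G x then (col y).+1 else 0.
have hstep : 2 * mono G col' setT setT + miss G col (nbr G x) (nbr G x)
    <= miss G col' setT setT + 2 * mono G col (nbr G x) (nbr G x).
  have := @furedi_step T G setT set0 x col (sub0set _).
  rewrite sx cards0 mul0n muln0 addn0; apply.
  by move=> y _; rewrite setD0 !setTI; apply: xmax; rewrite inE.
have lt y : col' y < r.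
  by rewrite /col'; case: ifP => // _; move: (colr y); lia.
exists (fun y => Ordinal (lt y)).
rewrite (_ : mono _ _ _ _ = mono G col' setT setT) //.
rewrite (_ : miss _ _ _ _ = miss G col' setT setT) //.
move: hcol; have := leq_mul (leqnn (K * P)) hstep; rewrite !mulnDr.
move: (mono _ _ _ _) (mono _ _ _ _) (miss _ _ _ _) (miss _ _ _ _) (_ * #|T| ^ 2) => a b c d t.
by lia.
Qed.

(** Turan's bound on the pairs with different colors shows that a coloring has few
    missing pairs as soon as it has few monochromatic edges ([turan] below); the
    only loss is the l m^2 pairs inside the parts.  Combined with the opposite
    inequality of [coloring_few_mono], this bounds both numbers for a maximum
    cut. *)
Lemma good_coloring : exists col : T -> 'I_r,
  [/\ forall v t, color_degree G col v (col v) <= color_degree G col v t,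
      threshold_ratio r ^ 2 * miss G col setT setT <= #|T| ^ 2
    & threshold_ratio r ^ 2 * mono G col setT setT <= #|T| ^ 2].
Proof.
have r0 : 0 < r by lia.
have turan (col : T -> 'I_r) : r * miss G col setT setT <=
    r * mono G col setT setT + r.-1 * (l * m ^ 2).
  have := pair_count G col setT setT; rewrite cardsT.
  set S := \sum_s _ => e.
  have hS : #|T| ^ 2 <= r * S.
    have [s hs] := sorted_by_exists (fun s => #|[set x in [set: T] | col x == s]|).
    have := chebyshev hs hs; rewrite -/S.
    suff -> : \sum_u #|[set x in [set: T] | col x == u]| = #|T| by [].
    rewrite -cardsT -[RHS]sum1_card (partition_big col predT) //=; apply: eq_bigr => u _.
    by rewrite -sum1_card; apply: eq_bigl => x; rewrite !inE.
  have lp : (l * l.-1 + l) * m ^ 2 = #|T| ^ 2.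
    rewrite hn expnMn; congr (_ * _); case: l => // q; rewrite /=; nia.
  have e1 := congr1 (muln r) e; have e3 := congr1 (muln r.-1) lp.
  have e4 : r * #|T| ^ 2 = r.-1 * #|T| ^ 2 + #|T| ^ 2 by rewrite -mulSnr prednK.
  rewrite !mulnDr -[#|T| * #|T|]/(#|T| ^ 2) in e1; rewrite mulnDl mulnDr in e3.
  move: hE hS e1 e3 e4.
  move: (r.-1 * _) (r.-1 * _) (r.-1 * _) (r * #|T| ^ 2) (r * edges _ _ _) (r * miss _ _ _ _).
  by move: (r * S) (r * mono _ _ _ _) (#|T| ^ 2) => *; lia.
have [col0 h0] := coloring_few_mono.
have [col [le_mono maxcut]] := max_cut_exists G col0.
exists col.
suff [hM hI] : threshold_ratio r ^ 2 * miss G col setT setT <= #|T| ^ 2 /\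
    threshold_ratio r ^ 2 * mono G col setT setT <= #|T| ^ 2 by [].
have t0 := turan col0; have t1 := turan col.
set e := (2 * K + _) * _ in h0; set a := r.-1 * (l * m ^ 2) in turan t0 t1.
have KP0 : 0 < K * P by rewrite muln_gt0 !expn_gt0.
have I0_le : K * P * (r * mono G col0 setT setT) <= K * P * a + r * e.
  move: (leq_mul (leqnn r) h0) (leq_mul (leqnn (K * P)) t0).
  move: (K * P) (mono _ _ _ _) (miss _ _ _ _) a e {t0 t1 turan h0 KP0}; clear.
  by move=> q I M a e; lia.
have a_le : a <= r * (l * m ^ 2) by rewrite leq_mul2r leq_pred orbT.
have bound X : K * P * (r * X) <= 2 * (K * P * a) + r * e ->
    threshold_ratio r ^ 2 * X <= #|T| ^ 2.
  move=> hX; have {}hX : K * P * X <= 2 * (K * P * (l * m ^ 2)) + e.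
    rewrite -(leq_pmul2l r0) mulnDr mulnCA; apply: leq_trans hX _.
    rewrite leq_add2r [r * _]mulnCA leq_mul2l /= [r * _]mulnCA leq_mul2l a_le orbT.
    by [].
  have k1 : 1 < r.+1 by lia.
  have l8 : 8 * threshold_ratio r ^ 2 <= l.
    by apply: leq_trans hl; apply: threshold_ratio_sq8 => //; move: r2; clear; lia.
  have P8 : 8 * threshold_ratio r ^ 2 <= P by apply: threshold_ratio_sq8 => //; lia.
  have K8 : 8 * (r - 2) * threshold_ratio r ^ 2 <= K by apply: threshold_ratio_sq8_sub2.
  rewrite -(leq_pmul2l KP0) -(@leq_pmul2l 8) //.
  have b1 : 8 * (threshold_ratio r ^ 2 * (2 * (K * P * (l * m ^ 2)))) <= 2 * (K * P * #|T| ^ 2).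
    have h1 := leq_mul l8 (leqnn (2 * (K * P * (l * m ^ 2)))).
    rewrite mulnA; apply: leq_trans h1 _; apply: eq_leq; rewrite hn.
    by ring.
  have b2 : 8 * (threshold_ratio r ^ 2 * (2 * K * #|T| ^ 2)) <= 2 * (K * P * #|T| ^ 2).
    have h1 := leq_mul P8 (leqnn (2 * K * #|T| ^ 2)).
    by rewrite mulnA; apply: leq_trans h1 _; apply: eq_leq; ring.
  have b3 : 8 * (threshold_ratio r ^ 2 * (4 * ((r - 2) * P) * #|T| ^ 2)) <= 4 * (K * P * #|T| ^ 2).
    have h1 := leq_mul K8 (leqnn (4 * P * #|T| ^ 2)).
    rewrite (_ : 8 * _ = 8 * (r - 2) * threshold_ratio r ^ 2 * (4 * P * #|T| ^ 2)); last by ring.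
    by apply: leq_trans h1 _; apply: eq_leq; ring.
  have h1 := leq_mul (leqnn (8 * threshold_ratio r ^ 2)) hX.
  apply: (@leq_trans (8 * threshold_ratio r ^ 2 * (K * P * X))); first by apply: eq_leq; ring.
  apply: leq_trans h1 _; rewrite /e mulnDl -(mulnA 8).
  move: b1 b2 b3; move: (K * P * #|T| ^ 2) (K * P * _) (2 * K * _) (4 * _ * _).
  move: (threshold_ratio r ^ 2).
  by clear; move=> L t x y z; lia.
have le1 := leq_mul (leqnn (K * P * r)) le_mono.
have t1' := leq_mul (leqnn (K * P)) t1.
rewrite -!mulnA in le1; rewrite mulnDr in t1'.
by split; apply: bound; move: le1 t1' I0_le; rewrite -?mulnA;
  move: (K * (P * _)) (K * (P * _)) (K * (P * _)) (K * (P * _)) (r * e);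
  clear=> *; lia.
Qed.

End GoodColoring.

(** * Parts with the same ranking of colors *)

Section Parts.

Variables (T : finType) (G : graph T) (r l m : nat) (p : T -> 'I_l).

Definition part (i : 'I_l) : {set T} := [set x | p x == i].

Definition class_size (col : T -> 'I_r) (i : 'I_l) (s : 'I_r) : nat :=
  #|[set x in part i | col x == s]|.

Hypothesis r0 : 0 < r.
Hypothesis card_part : forall i, #|part i| = m.
Hypothesis adj_part : forall x y, G x y -> p x != p y.
Hypothesis density_part : forall i j, i != j ->
  r.-1 * m ^ 2 <= r * edges G (part i) (part j).

Lemma sum_class_size col i : \sum_s class_size col i s = m.
Proof.
rewrite -(card_part i) -sum1_card (partition_big col predT) //=.
by apply: eq_bigr => s _; rewrite /class_size -sum1_card /=; apply: eq_bigl => x; rewrite !inE.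
Qed.

(** The density condition in terms of the coloring: missing pairs and a large
    scalar product of class sizes must be compensated by monochromatic edges. *)
Lemma class_size_density col i j : i != j ->
  r * miss G col (part i) (part j) + r * (\sum_s class_size col i s * class_size col j s)
    <= m ^ 2 + r * mono G col (part i) (part j).
Proof.
move=> ij; have := density_part ij; have := pair_count G col (part i) (part j).
rewrite !card_part -/(\sum_s class_size col i s * class_size col j s).
move: (\sum_s _) => S e; have e' := congr1 (muln r) e; rewrite !mulnDr in e'.
have e4 : r * (m * m) = r.-1 * m ^ 2 + m ^ 2 by rewrite -mulSnr prednK.
move: e' e4; move: (r * edges _ _ _) (r * miss _ _ _ _) (r * mono _ _ _ _) (r * S).
by move: (r * _) (r.-1 * _) => *; lia.
Qed.

Lemma class_size_sorted col (s : 'S_r) i j :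
    sorted_by s (class_size col i) -> sorted_by s (class_size col j) ->
  m ^ 2 <= r * (\sum_s class_size col i s * class_size col j s).
Proof. by move=> si sj; have := chebyshev si sj; rewrite !sum_class_size. Qed.

Section Ordered.

Variables (col : T -> 'I_r) (J : {set 'I_l}) (s : 'S_r).
Hypothesis sortedJ : forall i, i \in J -> sorted_by s (class_size col i).

Let VJ : {set T} := [set x | p x \in J].

(** For similarly ordered parts Chebyshev's inequality removes the scalar product
    from [class_size_density]. *)
Lemma miss_le_mono i j : i \in J -> j \in J -> i != j ->
  miss G col (part i) (part j) <= mono G col (part i) (part j).
Proof.
move=> iJ jJ ij; have := class_size_density col ij.
have := class_size_sorted (sortedJ iJ) (sortedJ jJ) => h1 h2.
by rewrite -(leq_pmul2l r0); move: h1 h2; move: (r * _) (r * _) (r * _) => *; lia.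
Qed.

Lemma sum_pairs_parts (R : T -> T -> nat) :
  \sum_(v in VJ) \sum_(y in VJ | p y != p v) R v y
   = \sum_(i in J) \sum_(j in J | j != i) \sum_(v in part i) \sum_(y in part j) R v y.
Proof.
rewrite (partition_big p (mem J)) /=; last by move=> x; rewrite inE.
apply: eq_bigr => i iJ; rewrite exchange_big /=.
apply: eq_big => [v|v].
  by rewrite !inE; case: eqP => [->|]; rewrite ?iJ ?andbF.
move=> /andP[_ /eqP vi].
rewrite (partition_big p (fun j => (j \in J) && (j != i))) /=; last first.
  by move=> x; rewrite inE vi.
apply: eq_bigr => j /andP[jJ ji]; apply: eq_bigl => y.
by rewrite !inE vi; case: (p y =P j) => [->|]; rewrite ?jJ ?ji ?andbF.
Qed.

Lemma edges_parts : r.-1 * (#|J| * #|J|.-1 * m ^ 2) <= r * edges G VJ VJ.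
Proof.
have -> : edges G VJ VJ = \sum_(i in J) \sum_(j in J | j != i) edges G (part i) (part j).
  rewrite -sum_pairs_parts; apply: eq_bigr => v _.
  rewrite big_mkcond [RHS]big_mkcond /=; apply: eq_bigr => y _.
  have [yV|//] := boolP (y \in VJ); case: eqP => [e|//]; rewrite /=.
  by case vy : (G v y) => //; have := adj_part vy; rewrite e eqxx.
rewrite (_ : _ * _ = \sum_(i in J) \sum_(j in J | j != i) r.-1 * m ^ 2).
  rewrite big_distrr /=; apply: leq_sum => i iJ; rewrite big_distrr /=.
  by apply: leq_sum => j /andP[jJ ji]; apply: density_part; rewrite eq_sym.
rewrite -[RHS]/(\sum_(i in J) _) (eq_bigr (fun=> #|J|.-1 * (r.-1 * m ^ 2))).
  by rewrite sum_nat_const; ring.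
move=> i iJ; rewrite (cardsD1 i) iJ /= -sum_nat_const; apply: eq_bigl => j.
by rewrite !inE andbC.
Qed.

Lemma card_VJ : #|VJ| = #|J| * m.
Proof.
rewrite -sum1_card (partition_big p (mem J)) /=; last by move=> x; rewrite inE.
rewrite -sum_nat_const; apply: eq_bigr => i iJ; rewrite -(card_part i) -sum1_card.
by apply: eq_bigl => x; rewrite !inE; case: eqP => [->|]; rewrite ?iJ ?andbF.
Qed.

(** All color classes are large on J, by a variance argument: [pair_count] on the
    union of the parts in J bounds the sum of the squares of the class sizes by
    N^2 / r plus a small error, so each class size is close to N / r. *)
Lemma classes_large d : 0 < m -> 64 * r ^ 2 <= #|J| ->
    64 * r ^ 2 * mono G col setT setT <= (#|J| * m) ^ 2 ->
    8 * r * d <= #|J| * m + 8 * r ->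
  forall t, 5 * d + 2 * m <= #|[set x in VJ | col x == t]|.
Proof.
move=> m0 J_large mono_small d_small t.
set N := #|J| * m in mono_small d_small *.
pose u s := #|[set x in VJ | col x == s]|; rewrite -/(u t).
have sum_u : \sum_s u s = N.
  rewrite /N -card_VJ -sum1_card (partition_big col predT) //=; apply: eq_bigr => s0 _.
  by rewrite /u -sum1_card /=; apply: eq_bigl => x; rewrite !inE.
pose I := mono G col VJ VJ.
have I_le : I <= mono G col setT setT.
  rewrite /I /mono [X in _ <= X](big_setID VJ) /= (setIidPr (subsetT _)).
  apply: leq_trans (leq_addr _ _); apply: leq_sum => x _.
  by rewrite [X in _ <= X](big_setID VJ) /= (setIidPr (subsetT _)) leq_addr.
have sq_u : r * (\sum_s u s ^ 2) + r.-1 * (#|J| * #|J|.-1 * m ^ 2) <= r * (N * N) + r * I.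
  have := pair_count G col VJ VJ; rewrite card_VJ -/N => e.
  have := edges_parts; have := congr1 (muln r) e; rewrite !mulnDr -/I.
  rewrite -/(\sum_s u s ^ 2); move: (\sum_s _) (r.-1 * _) => S E.
  move: (r * edges _ _ _) (r * miss _ _ _ _) (r * S) (r * I) (r * (N * N)).
  by move=> *; lia.
have var : (r * u t) ^ 2 + N ^ 2 + 2 * r * N * N <=
    r ^ 2 * (\sum_s u s ^ 2) + r * N ^ 2 + 2 * r * N * u t.
  have -> : r ^ 2 * (\sum_s u s ^ 2) + r * N ^ 2 = \sum_s ((r * u s) ^ 2 + N ^ 2).
    rewrite big_split /= sum_nat_const card_ord big_distrr /=; congr (_ + _).
    by apply: eq_bigr => s0 _; rewrite expnMn.
  have -> : 2 * r * N * N = \sum_s 2 * r * N * u s by rewrite -big_distrr /= sum_u.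
  rewrite (bigD1 t) //= [X in _ <= X + _](bigD1 t) //= [X in _ + X <= _]addnC addnA.
  rewrite leq_add2r leq_add2l; apply: leq_sum => s0 _.
  by have [h _] := nat_Cauchy (r * u s0) N; apply: leq_trans h; apply: eq_leq; ring.
have JN : N * N = #|J| * #|J|.-1 * m ^ 2 + N * m.
  have J0 : 0 < #|J| by apply: leq_trans J_large; rewrite muln_gt0 expn_gt0 r0.
  by rewrite /N; case: #|J| J0 => // q _; rewrite /=; ring.
set S := \sum_s _ in sq_u var; set a := r * u t in var *.
have h1 : r * S <= N * N + r * I + r.-1 * (N * m).
  have e : r * (N * N) = r.-1 * (N * N) + N * N by rewrite -mulSnr prednK.
  have e' := congr1 (muln r.-1) JN; rewrite mulnDr in e'.
  move: sq_u; rewrite e e'; move: (r * S) (r.-1 * _) (r * I) (N * N) (r.-1 * _) => *; lia.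
have h2 : a ^ 2 + N ^ 2 <= r ^ 2 * I + r ^ 2 * (N * m) + 2 * N * a.
  have h3 := leq_mul (leqnn r) h1; rewrite !mulnDr in h3.
  have h4 : r * (r.-1 * (N * m)) <= r ^ 2 * (N * m).
    by rewrite mulnA leq_mul2r -mulnn leq_mul2l leq_pred !orbT.
  have e1 : 2 * r * N * u t = 2 * N * a by rewrite /a; ring.
  have e2 : r ^ 2 * S = r * (r * S) by ring.
  have e3 : r ^ 2 * I = r * (r * I) by ring.
  have e4 : r * N ^ 2 = r * (N * N) by ring.
  have e5 : 2 * r * N * N = r * (N * N) + r * (N * N) by ring.
  move: var h3 h4; rewrite e1 e2 e3 e4 e5.
  move: (r * (r * S)) (r * (r * I)) (r * (N * N)) (r * (r.-1 * _)) (r ^ 2 * _).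
  by move: (2 * N * a) (a ^ 2) (N ^ 2) => *; lia.
have h5 : 64 * r ^ 2 * I <= N ^ 2.
  by apply: leq_trans mono_small; rewrite leq_mul2l I_le orbT.
have h6 : 64 * r ^ 2 * (N * m) <= N ^ 2.
  by apply: leq_trans (leq_mul J_large (leqnn _)) _; rewrite /N; apply: eq_leq; ring.
have h7 : 64 * (a ^ 2 + N ^ 2) <= 2 * N ^ 2 + 64 * (2 * N * a).
  have := leq_mul (leqnn 64) h2; rewrite !mulnDr !mulnA -!(mulnA 64).
  by rewrite !(mulnA 64 (r ^ 2)); move: h5 h6; lia.
have N0 : 0 < N.
  by rewrite muln_gt0 m0 andbT; apply: leq_trans J_large; rewrite muln_gt0 expn_gt0 r0.
(* If a were less than 4/5 N, its distance b to N would satisfy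
   25 b^2 > N^2 as well as 32 b^2 <= N^2. *)
have h8 : 4 * N <= 5 * a.
  rewrite leqNgt; apply/negP => lt.
  have [b eb] : exists b, N = a + b by exists (N - a); lia.
  have {}lt : N < 5 * b by lia.
  have h9 : 32 * (b * b) <= N * N.
    move: h7; rewrite !expnS !expn0 !muln1.
    have -> : a * a + N * N = b * b + 2 * (N * a) by rewrite eb; ring.
    by rewrite -(mulnA 2 N); move: (N * a) (N * N) (b * b) => *; lia.
  have := ltn_mul lt lt; move: h9; move: (N * N) => n2.
  by rewrite mulnACA; move: (b * b) => b2; lia.
have h10 : 64 * r * m <= N.
  rewrite /N leq_mul2r; apply/orP; right; apply: leq_trans J_large.
  by rewrite leq_mul2l /= expnS expn1 leq_pmulr.
have h11 : r <= r * m by rewrite leq_pmulr.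
rewrite -(leq_pmul2l r0) -/a mulnDr.
have -> : r * (5 * d) = 5 * (r * d) by ring.
have -> : r * (2 * m) = 2 * (r * m) by ring.
move: h8 h10 d_small h11; rewrite -!mulnA; move: (r * d) (r * m) => *; lia.
Qed.

(* Missing pairs and monochromatic edges at v, both restricted to J. *)
Let missJ v := \sum_(y in VJ | p y != p v) (~~ G v y && (col v != col y)).
Let monoJ v := \sum_(y in VJ | p y != p v) (G v y && (col v == col y)).

Lemma sum_missJ_le : \sum_(v in VJ) missJ v <= \sum_(v in VJ) monoJ v.
Proof.
rewrite /missJ /monoJ !sum_pairs_parts; apply: leq_sum => i iJ.
by apply: leq_sum => j /andP[jJ ji]; apply: miss_le_mono; rewrite // eq_sym.
Qed.

Variable d : nat.
Hypothesis d0 : 0 < d.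
Hypothesis maxcut : forall v t, color_degree G col v (col v) <= color_degree G col v t.
(* There is no rich configuration, up to the degenerate case of an empty
   distinguished set. *)
Hypothesis not_rich : forall v u (D : 'I_r -> {set T}),
  rich G col d v u D -> D u = set0.
Hypothesis classJ_large : forall t, 5 * d + 2 * m <= #|[set x in VJ | col x == t]|.

(** With d monochromatic edges at v, the maximum cut would give v at least d
    neighbors in every class, which is a rich configuration. *)
Lemma monoJ_lt v : monoJ v < d.
Proof.
rewrite ltnNge; apply/negP => dv.
pose D t : {set T} := [set y in nbr G v | col y == t].
have Dd t : d <= #|D t|.
  apply: leq_trans (maxcut v t); apply: leq_trans dv _.
  rewrite /monoJ /color_degree -sum1_card big_mkcond [X in _ <= X]big_mkcond /=.
  apply: leq_sum => y _; rewrite !inE [col y == _]eq_sym.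
  by case: (_ \in J); case: (p y != _); case: (G v y); case: (col v == _).
have D0 : D (col v) = set0.
  apply: (@not_rich v); split => //.
  - by move=> t x; rewrite !inE => /andP[].
  - by move=> t x _; rewrite !inE => /andP[_ /eqP].
  - by left; split => // x; rewrite !inE => /andP[_ /eqP].
by have := Dd (col v); rewrite D0 cards0 leqNgt d0.
Qed.

Let deficient := [set v in VJ | 2 * d <= missJ v].

(** The ends v and w of a monochromatic edge have fewer than d common neighbors in
    some other class t, since otherwise the edge is a rich configuration.  All
    other vertices of class t on J, outside the parts of v and w, are thus missed
    by v or by w; there are at least 4 d of them. *)
Lemma mono_edge_deficient v w : v \in VJ -> w \in VJ -> G v w -> col v = col w ->
  (v \in deficient) || (w \in deficient).
Proof.
move=> vJ wJ vw cvw; rewrite [v \in _]inE [w \in deficient]inE vJ wJ /=.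
apply: contraT; rewrite negb_or -!ltnNge.
move=> /andP[mv mw].
pose u := col v.
pose D t : {set T} := if t == u then [set w] else [set y in nbr G v :&: nbr G w | col y == t].
have DE t : t != u -> D t = [set y in nbr G v :&: nbr G w | col y == t].
  by rewrite /D => /negbTE ->.
have [t tu Dt] : exists2 t, t != u & #|D t| < d.
  apply/exists_inP; apply: contraT => /exists_inPn h.
  have : D u = set0.
    apply: (@not_rich v); split.
    - move=> t x; rewrite /D; case: eqP => _; rewrite !inE; first by move/eqP ->.
      by case/andP => /andP[].
    - by move=> t x tu; rewrite DE // !inE => /andP[_ /eqP].
    - by move=> t tu; rewrite leqNgt; apply: h.
    - right => t x y tu; rewrite (DE t) // {1}/D eqxx !inE => /eqP ->.
      by case/andP => /andP[].
  by rewrite /D eqxx => /setP/(_ w); rewrite !inE eqxx.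
pose M z : {set T} := [set y in VJ | [&& p y != p z, ~~ G z y & col z != col y]].
have ME z : missJ z = #|M z|.
  rewrite /missJ -sum1_card big_mkcond [RHS]big_mkcond /=; apply: eq_bigr => y _.
  by rewrite !inE; case: (_ \in J); case: (_ != _); case: (~~ _ && _).
have sub : [set x in VJ | col x == t] \subset
    D t :|: (part (p v) :|: part (p w)) :|: (M v :|: M w).
  apply/subsetP => x; rewrite DE // !inE -cvw => /andP[-> /eqP xt].
  rewrite -xt -/u in tu *; rewrite eqxx (eq_sym u) tu /=.
  by case: (G v x); case: (G w x); case: (p x == p v); case: (p x == p w).
have := leq_trans (classJ_large t) (subset_leq_card sub).
have c1 := leq_of_leqif (leq_card_setU (D t :|: (part (p v) :|: part (p w))) (M v :|: M w)).
have c2 := leq_of_leqif (leq_card_setU (D t) (part (p v) :|: part (p w))).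
have c3 := leq_of_leqif (leq_card_setU (part (p v)) (part (p w))).
have c4 := leq_of_leqif (leq_card_setU (M v) (M w)).
rewrite !card_part in c3; rewrite !ME in mv mw; lia.
Qed.

(** Every monochromatic edge meets a deficient vertex, and such a vertex has more
    missing pairs than twice its monochromatic edges.  If there were any, missing
    pairs would outnumber monochromatic edges on J. *)
Lemma no_deficient : deficient = set0.
Proof.
have le1 : \sum_(v in VJ) monoJ v <= 2 * \sum_(v in deficient) monoJ v.
  pose e v w : nat := [&& v \in VJ, w \in VJ, p w != p v, G v w & col v == col w].
  have eE v : v \in VJ -> monoJ v = \sum_w e v w.
    move=> vJ; rewrite /monoJ big_mkcond /=; apply: eq_bigr => w _.
    by rewrite /e vJ; case: (_ \in _); case: (_ != _).
  have eb : \sum_(v in deficient) monoJ v = \sum_v \sum_w (v \in deficient) * e v w.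
    rewrite big_mkcond /=; apply: eq_bigr => v _; case: ifP => vb.
      rewrite eE; first by apply: eq_bigr => w _; rewrite mul1n.
      by move: vb; rewrite inE => /andP[].
    by rewrite big1.
  have eb' : \sum_(v in deficient) monoJ v = \sum_v \sum_w (w \in deficient) * e v w.
    rewrite eb exchange_big /=; apply: eq_bigr => v _; apply: eq_bigr => w _.
    congr (_ * _); rewrite /e adj_sym eq_sym [col w == _]eq_sym.
    by case: (v \in VJ); case: (w \in VJ).
  rewrite mul2n -addnn {1}eb eb' -big_split /= big_mkcond /=; apply: leq_sum => v _.
  case: ifP => // vJ; rewrite eE // -big_split /=; apply: leq_sum => w _.
  rewrite -mulnDl /e; case: and5P => [[_ wJ _ vw /eqP cvw]|]; last by rewrite muln0.
  by have := mono_edge_deficient vJ wJ vw cvw; case: (v \in deficient); case: (w \in deficient).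
have le2 : \sum_(v in deficient) missJ v <= \sum_(v in VJ) missJ v.
  rewrite [X in _ <= X](big_setID deficient) /= (setIidPr _) ?leq_addr //.
  by apply/subsetP => v; rewrite inE => /andP[].
have le3 : \sum_(v in deficient) missJ v <= \sum_(v in deficient) 2 * monoJ v.
  by rewrite -big_distrr /=; apply: leq_trans le2 (leq_trans sum_missJ_le le1).
apply/eqP; apply: contraT => /set0Pn[v vb]; move: le3; rewrite leqNgt => /negP[].
rewrite (bigD1 v) //= [X in _ < X](bigD1 v) //= -addSn.
have lt u : u \in deficient -> 2 * monoJ u < missJ u.
  rewrite inE => /andP[_]; apply: leq_trans; have := monoJ_lt u; lia.
apply: leq_add; first exact: lt.
by apply: leq_sum => u /andP[/lt/ltnW].
Qed.

Lemma ordered_parts_complete x y : p x \in J -> p y \in J -> p x != p y -> G x y = (col x != col y).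
Proof.
move=> xJ yJ xy.
have mono0 v : v \in VJ -> monoJ v = 0.
  move=> vJ; apply: big1 => w /andP[wJ _]; case: andP => // -[vw /eqP cvw].
  by have := mono_edge_deficient vJ wJ vw cvw; rewrite no_deficient !inE.
have xV : x \in VJ by rewrite inE.
have yV : y \in VJ by rewrite inE.
have miss0 : missJ x = 0.
  have := sum_missJ_le; rewrite [X in _ <= X]big1 // leqn0 sum_nat_eq0.
  by move/forall_inP => /(_ x xV)/eqP.
have := mono0 x xV; have := miss0; rewrite /monoJ /missJ.
rewrite (bigD1 y) /=; last by rewrite yV eq_sym.
rewrite [X in _ -> X = 0 -> _](bigD1 y) /=; last by rewrite yV eq_sym.
by case: (G x y); case: (col x == col y).
Qed.

(** Between two parts of J there are neither monochromatic edges nor missing pairs,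
    so the density condition holds only with equality in Chebyshev's
    inequality. *)
Lemma ordered_parts_uniform i j : i \in J -> j \in J -> i != j ->
  uniform (class_size col i) || uniform (class_size col j).
Proof.
move=> iJ jJ ij; apply: (chebyshev_eq (sortedJ iJ) (sortedJ jJ)).
rewrite !sum_class_size; have := class_size_density col ij.
rewrite [mono _ _ _ _]big1 ?muln0 ?addn0.
  by apply: leq_trans; rewrite leq_addl.
move=> x; rewrite inE => /eqP xi; rewrite big1 // => y; rewrite inE => /eqP yj.
by rewrite ordered_parts_complete ?xi ?yj //; case: (_ == _).
Qed.

End Ordered.

End Parts.

(** * Extending the coloring of a core to all vertices *)

(** The core is the union of the parts in J, colored by col: all classes of all
    its parts have size q, and adjacency between different parts is given by the
    colors. *)
Section Core.

Variables (T : finType) (G : graph T) (r l m : nat) (p : T -> 'I_l).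
Hypothesis r0 : 0 < r.
Hypothesis card_part : forall i, #|part p i| = m.
Hypothesis m0 : 0 < m.
Hypothesis density_part : forall i j, i != j ->
  r.-1 * m ^ 2 <= r * edges G (part p i) (part p j).

Variables (col : T -> 'I_r) (J : {set 'I_l}) (d q : nat).
Hypothesis d0 : 0 < d.
Hypothesis not_rich : forall v u (D : 'I_r -> {set T}),
  rich G col d v u D -> D u = set0.
Hypothesis mq : m = r * q.
Hypothesis class_core : forall i t, i \in J -> class_size p col i t = q.
Hypothesis adj_core : forall x y, p x \in J -> p y \in J -> p x != p y ->
  G x y = (col x != col y).
Hypothesis core_large : 2 * (d + q) < (#|J| - 1) * q.

Definition core_class (I : {set 'I_l}) t : {set T} := [set y | (p y \in I) && (col y == t)].

Lemma card_core_class (I : {set 'I_l}) t : I \subset J -> #|core_class I t| = #|I| * q.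
Proof.
move=> /subsetP IJ; rewrite -sum1_card (partition_big p (mem I)) /=; last first.
  by move=> x; rewrite inE => /andP[].
rewrite -sum_nat_const; apply: eq_bigr => i iI; rewrite -(class_core t (IJ i iI)).
rewrite /class_size -sum1_card; apply: eq_bigl => x; rewrite !inE.
by case: (p x =P i) => [->|]; rewrite ?iI ?andbF ?andbT.
Qed.

(* The part of v is left out, because v has no neighbors there. *)
Let deg v t := #|core_class (J :\ p v) t :&: nbr G v|.

Lemma deg_le v t : deg v t <= #|J :\ p v| * q.
Proof.
rewrite -(card_core_class t (subsetDl _ _)).
by apply/subset_leq_card/subsetIl.
Qed.

(** Suppose v has a neighbor in every core class, and let w be one in the class s
    where v has the fewest.  As v w is not a rich configuration, v has few
    neighbors in some further class t, hence also in s.  Two sparse classes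
    cost v more neighbors than missing one class completely. *)
Lemma deg_positive v : (forall t, 0 < deg v t) -> \sum_t deg v t < r.-1 * (#|J :\ p v| * q).
Proof.
move=> dpos; set C := _ * q.
have [s _ smin] := @arg_minnP _ (Ordinal r0) predT (fun t => deg v t) isT.
have /card_gt0P[w] := dpos s; rewrite !inE => /andP[/andP[/andP[wv wJ] /eqP ws] vw].
pose D t : {set T} := if t == s then [set w]
  else core_class (J :\ p v :\ p w) t :&: nbr G v.
have DE t : t != s -> D t = core_class (J :\ p v :\ p w) t :&: nbr G v.
  by rewrite /D => /negbTE ->.
have degD t : deg v t <= #|core_class (J :\ p v :\ p w) t :&: nbr G v| + q.
  rewrite -(class_core t wJ) /class_size.
  apply: leq_trans (leq_of_leqif (leq_card_setU _ _)).
  apply/subset_leq_card/subsetP => x; rewrite !inE => /andP[/andP[/andP[-> ->] ->] ->].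
  by case: (_ == p w).
have [t ts Dt] : exists2 t, t != s & #|D t| < d.
  apply/exists_inP; apply: contraT => /exists_inPn h.
  have : D s = set0.
    apply: (@not_rich v); split.
    - move=> t x; rewrite /D; case: eqP => _; rewrite !inE; first by move/eqP ->.
      by case/andP.
    - by move=> t x ts; rewrite DE // !inE => /andP[/andP[_ /eqP]].
    - by move=> t ts; rewrite leqNgt; apply: h.
    - right => t x y ts; rewrite (DE t) // {1}/D eqxx !inE => /eqP ->.
      case/andP => /andP[/and3P[yw yv yJ] /eqP yt] _.
      by rewrite adj_core ?ws ?yt // eq_sym.
  by rewrite /D eqxx => /setP/(_ w); rewrite !inE eqxx.
have C_large : 2 * (d + q) < C.
  apply: leq_trans core_large _; rewrite leq_mul2r; apply/orP; right.
  by rewrite (cardsD1 (p v) J) leq_subLR leq_add2r leq_b1.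
have dt : deg v t < d + q.
  by apply: leq_ltn_trans (degD t) _; rewrite ltn_add2r -DE.
have ds : deg v s <= deg v t by apply: smin.
have r2 : 2 <= r.
  by move: ts (ltn_ord s) (ltn_ord t); rewrite -val_eqE /= => /eqP; lia.
rewrite (bigD1 s) //= (bigD1 t) //=.
have rest : \sum_(u | (u != s) && (u != t)) deg v u <= (r - 2) * C.
  have -> : r - 2 = #|[set u : 'I_r | (u != s) && (u != t)]|.
    have := cardsC [set s; t]; rewrite cards2 eq_sym ts card_ord /=.
    rewrite (_ : ~: [set s; t] = [set u | (u != s) && (u != t)]); first (move: #|_| => x; lia).
    by apply/setP => u; rewrite !inE negb_or.
  rewrite -sum_nat_const big_mkcond [X in _ <= X]big_mkcond /=.
  by apply: leq_sum => u _; rewrite inE; case: ifP => // _; apply: deg_le.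
have -> : r.-1 * C = (r - 2) * C + C by rewrite -[X in _ + X]mul1n -mulnDl; congr (_ * _); lia.
by move: rest; move: (_ * C) (\sum_(_ | _) _) => *; lia.
Qed.

Lemma deg_bound v : \sum_t deg v t <= r.-1 * (#|J :\ p v| * q) /\
  (\sum_t deg v t = r.-1 * (#|J :\ p v| * q) ->
   exists s, deg v s = 0 /\ forall t, t != s -> deg v t = #|J :\ p v| * q).
Proof.
case: (pickP (fun s => deg v s == 0)) => [s /eqP ds|dpos]; last first.
  have lt : \sum_t deg v t < r.-1 * (#|J :\ p v| * q).
    by apply: deg_positive => t; rewrite lt0n; apply/negP; rewrite dpos.
  by split; [apply: ltnW | move=> e; rewrite e ltnn in lt].
have cs : r.-1 = #|[set t | t != s]|.
  rewrite (_ : [set t | t != s] = [set~ s]) ?cardsC1 ?card_ord //.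
  by apply/setP => t; rewrite !inE.
rewrite (bigD1 s) //= ds add0n cs -sum_nat_const.
rewrite [X in _ <= X /\ (_ = X -> _)](eq_bigl (fun t => t != s)); last by move=> t; rewrite inE.
split; first by apply: leq_sum => t _; apply: deg_le.
move=> e; exists s; split => // t ts; apply/eqP; rewrite eqn_leq deg_le /= leqNgt.
apply/negP => lt; have : \sum_(t | t != s) deg v t < \sum_(t | t != s) #|J :\ p v| * q.
  rewrite (bigD1 t) //= [X in _ < X](bigD1 t) //= -addSn; apply: leq_add => //.
  by apply: leq_sum => u _; apply: deg_le.
by rewrite e ltnn.
Qed.

(** The density condition, summed over the core parts other than i: on average, a
    vertex of part i attains the upper bound of [deg_bound]. *)
Lemma sum_deg i :
  m * (r.-1 * (#|J :\ i| * q)) <= \sum_(v in part p i) \sum_t deg v t.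
Proof.
have -> : \sum_(v in part p i) \sum_t deg v t = \sum_(j in J :\ i) edges G (part p i) (part p j).
  rewrite /edges [RHS]exchange_big /=; apply: eq_bigr => v; rewrite inE => /eqP vi.
  rewrite (eq_bigr (fun t => \sum_(y in nbr G v | (p y \in J :\ i) && (col y == t)) 1)); last first.
    move=> t _; rewrite /deg vi -sum1_card; apply: eq_bigl => y; rewrite !inE.
    by rewrite andbC.
  have e1 : \sum_(y in nbr G v | p y \in J :\ i) 1 =
      \sum_t \sum_(y in nbr G v | (p y \in J :\ i) && (col y == t)) 1.
    rewrite (partition_big col predT) //=; apply: eq_bigr => t _.
    by apply: eq_bigl => y; rewrite andbA.
  rewrite -e1 (partition_big p (mem (J :\ i))) /=; last by move=> y /andP[].
  apply: eq_bigr => j jJ; rewrite big_mkcond [RHS]big_mkcond; apply: eq_bigr => y _ /=.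
  rewrite !inE; case: (p y =P j) => [->|]; last by rewrite andbF.
  by move: jJ; rewrite !inE => ->; case: (G v y).
rewrite -(leq_pmul2l r0) big_distrr /=.
apply: (@leq_trans (\sum_(j in J :\ i) r.-1 * m ^ 2)).
  by rewrite sum_nat_const; apply: eq_leq; rewrite [in RHS]expnS expn1 {3}mq; ring.
by apply: leq_sum => j; rewrite !inE => /andP[ji _]; apply: density_part; rewrite eq_sym.
Qed.

(** No vertex exceeds the bound of [deg_bound] and the average attains it, so
    every vertex does. *)
Lemma core_color v : exists s, forall y, p y \in J :\ p v -> G v y = (col y != s).
Proof.
have e : \sum_t deg v t = r.-1 * (#|J :\ p v| * q).
  apply/eqP; rewrite eqn_leq (deg_bound v).1 /= leqNgt; apply/negP => lt.
  have := sum_deg (p v); rewrite leqNgt => /negP[].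
  have vp : v \in part p (p v) by rewrite inE.
  rewrite -(card_part (p v)) -sum_nat_const.
  rewrite (bigD1 v) //= [X in _ < X](bigD1 v) //= -addSn; apply: leq_add => //.
  apply: leq_sum => u /andP[+ _]; rewrite inE => /eqP up.
  by have := (deg_bound u).1; rewrite up.
have [s [ds dt]] := (deg_bound v).2 e.
exists s => y yJ; have [ys|ys] := eqVneq (col y) s.
  apply/negbTE/negP => vy; move: ds => /eqP; rewrite cards_eq0 => /eqP/setP/(_ y).
  by rewrite !inE in yJ *; rewrite ys eqxx yJ vy.
have := dt _ ys; rewrite -(card_core_class (col y) (subsetDl J [set p v])) /deg => /eqP.
rewrite eqn_leq => /andP[_ h].
have /eqP/setP/(_ y) : core_class (J :\ p v) (col y) :&: nbr G v == core_class (J :\ p v) (col y).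
  by rewrite eqEcard subsetIl.
by rewrite !inE in yJ *; rewrite yJ eqxx.
Qed.

(** Color each vertex by the core class that it misses.  An edge v w between
    vertices of one color s has all core vertices of the other classes as common
    neighbors, apart from the parts of v and w.  Since col may give w another
    color than s, the alternative in the definition of [rich] that leaves D s
    uncolored is essential here. *)
Lemma core_extends : exists c : T -> 'I_r, forall x y, G x y -> c x != c y.
Proof.
have [c hc] := fin_all_exists core_color.
exists c => v w vw; apply/eqP => cvw; set s := c v in cvw.
have hv := hc v; have hw := hc w; rewrite -/s in hv; rewrite -cvw in hw.
pose I := J :\ p v :\ p w.
pose D t : {set T} := if t == s then [set w] else core_class I t.
have DE t : t != s -> D t = core_class I t by rewrite /D => /negbTE ->.
have IJ : I \subset J by rewrite /I; apply: subset_trans (subsetDl _ _) (subsetDl _ _).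
have cI : #|J| - 2 <= #|I|.
  rewrite (cardsD1 (p v) J) (cardsD1 (p w) (J :\ p v)) -/I.
  by rewrite leq_subLR addnA leq_add2r; apply: (leq_add (leq_b1 _) (leq_b1 _)).
have : D s = set0.
  apply: (@not_rich v); split.
  - move=> t x; rewrite /D; case: eqP => ts; rewrite !inE; first by move/eqP ->.
    case/andP => /and3P[xw xv xJ] /eqP xt; rewrite hv ?inE ?xv //.
    by rewrite xt; apply/eqP.
  - by move=> t x ts; rewrite DE // inE => /andP[_ /eqP].
  - move=> t ts; rewrite DE // card_core_class //.
    have : (#|J| - 2) * q <= #|I| * q by rewrite leq_mul2r cI orbT.
    move: core_large; rewrite !mulnBl; move: (_ * q) (_ * q) => *; lia.
  - right => t x y ts; rewrite (DE t) // {1}/D eqxx !inE => /eqP ->.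
    by case/andP => /and3P[yw yv yJ] /eqP yt; rewrite hw ?inE ?yw // yt.
by rewrite /D eqxx => /setP/(_ w); rewrite !inE eqxx.
Qed.

End Core.

(** * Existence of a proper coloring *)

Lemma popular_value (A B : finType) (f : A -> B) : 0 < #|B| ->
  exists b, #|A| <= #|B| * #|[set a | f a == b]|.
Proof.
move=> B0; apply/existsP; apply: contraT => /existsPn h.
have : \sum_(b : B) #|B| * #|[set a | f a == b]| < \sum_(b : B) #|A|.
  have /card_gt0P[b0 _] := B0.
  rewrite (bigD1 b0) //= [X in _ < X](bigD1 b0) //= -addSn; apply: leq_add.
    by rewrite ltnNge h.
  by apply: leq_sum => b _; rewrite ltnW // ltnNge h.
rewrite -big_distrr /= sum_nat_const.
have -> : \sum_(b : B) #|[set a | f a == b]| = #|A|.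
  rewrite -[RHS]sum1_card (partition_big f predT) //=; apply: eq_bigr => b _.
  by rewrite -sum1_card; apply: eq_bigl => a; rewrite inE.
by rewrite ltnn.
Qed.

Section ProperColoring.

Variables (T : finType) (G : graph T) (r l m : nat) (p : T -> 'I_l).
Hypothesis r2 : 2 <= r.
Hypothesis hl : r.+1 ^ (12 * r.+1) <= l.
Hypothesis m0 : 0 < m.
Hypothesis card_part : forall i, #|part p i| = m.
Hypothesis adj_part : forall x y, G x y -> p x != p y.
Hypothesis density_part : forall i j, i != j ->
  r.-1 * m ^ 2 <= r * edges G (part p i) (part p j).
Hypothesis nojoint : forall x y, G x y ->
  #|joint G r.+1 x y| * r.+1 ^ (2 * r.+1 ^ 2) < #|T| ^ r.-1.

Lemma rich_free (col : T -> 'I_r) (d : nat) : 0 < d -> #|T| <= d * threshold_ratio r ->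
    threshold_ratio r ^ 2 * miss G col setT setT <= #|T| ^ 2 ->
  forall v u (D : 'I_r -> {set T}), rich G col d v u D -> D u = set0.
Proof.
move=> d0 hd hM v u D hrich; have r0 : 0 < r by lia.
have L0 := threshold_ratio_gt0 r0.
have missd : miss G col setT setT <= d ^ 2.
  have L2 : 0 < threshold_ratio r ^ 2 by rewrite expn_gt0 L0.
  rewrite -(leq_pmul2l L2); apply: leq_trans hM _.
  by rewrite -expnMn leq_exp2r // mulnC.
apply/eqP; apply: contraT => Du.
have [w wD] := rich_joint hrich missd d0 Du; rewrite card_ord => hw.
have vw : G v w by case: hrich => h _ _ _; apply: h wD.
have := nojoint vw; rewrite ltnNge => /negP[].
apply: (@leq_trans ((d * threshold_ratio r) ^ r.-1)).
  by case: r r2 hd {hw hM missd} => [|[|q]] // _ hd; rewrite leq_exp2r.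
rewrite expnMn; apply: leq_trans (leq_mul hw (leqnn _)) _.
by rewrite mulnAC mulnC leq_mul2l mulnC [_ * 2]mulnC threshold_ratio_joint ?orbT.
Qed.

Lemma proper_coloring : exists c : T -> 'I_r, forall x y, G x y -> c x != c y.
Proof.
have r0 : 0 < r by lia.
have VT : [set x | p x \in [set: 'I_l]] = setT by apply/setP => x; rewrite !inE.
have hn : #|T| = l * m.
  by have := card_VJ card_part [set: 'I_l]; rewrite VT !cardsT card_ord.
have hE : r.-1 * (l * l.-1 * m ^ 2) <= r * edges G setT setT.
  by have := edges_parts adj_part density_part [set: 'I_l]; rewrite VT cardsT card_ord.
have [col [maxcut hM hI]] := good_coloring r2 hl hn hE nojoint.
have [order horder] := fin_all_exists (fun i => sorted_by_exists (class_size p col i)).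
have [|s hs] := @popular_value _ _ order; first by rewrite card_Sn fact_gt0.
rewrite card_ord card_Sn in hs; set J := [set i | _] in hs.
have sortedJ i : i \in J -> sorted_by s (class_size p col i).
  by rewrite inE => /eqP <-; apply: horder.
have J_large : 64 * r ^ 2 <= #|J|.
  have f0 : 0 < r`! by apply: fact_gt0.
  rewrite -(leq_pmul2l f0); apply: leq_trans hs; apply: leq_trans hl.
  have h1 : r`! <= r.+1 ^ r.
    apply: leq_trans (fact_le_exp r0) _; apply: (@leq_trans (r.+1 ^ r.-1)).
      by case: r => [|[|q]] //; rewrite leq_exp2r.
    by rewrite leq_exp2l // leq_pred.
  have h2 : 64 <= r.+1 ^ 4 by apply: (@leq_trans (3 ^ 4)) => //; rewrite leq_exp2r //; lia.
  have h3 : r ^ 2 <= r.+1 ^ 2 by rewrite leq_exp2r.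
  apply: leq_trans (leq_mul h1 (leq_mul h2 h3)) _.
  by rewrite -!expnD leq_exp2l //; lia.
(* The least natural number above N / (8 r); the additive 1 is harmless because
   #|J| is much larger than r. *)
set N := #|J| * m; pose d := (N %/ (8 * r)).+1.
have r8 : 0 < 8 * r by lia.
have d_small : 8 * r * d <= N + 8 * r.
  by rewrite /d mulnS addnC leq_add2r mulnC leq_trunc_div.
have d_large : N <= 8 * r * d by rewrite /d mulnC ltnW // ltn_ceil.
have n_le : #|T| <= r`! * N.
  by rewrite hn /N mulnA leq_mul2r hs orbT.
have hd : #|T| <= d * threshold_ratio r.
  apply: leq_trans n_le _; apply: leq_trans (leq_mul (leqnn _) d_large) _.
  by apply: eq_leq; rewrite /threshold_ratio; ring.
have rich0 := @rich_free col d (ltn0Sn _) hd hM.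
have mono_small : 64 * r ^ 2 * mono G col setT setT <= N ^ 2.
  have f0 : 0 < r`! ^ 2 by rewrite expn_gt0 fact_gt0.
  rewrite -(leq_pmul2l f0) -[X in _ <= X]expnMn.
  apply: (@leq_trans (#|T| ^ 2)); last by rewrite leq_exp2r.
  by apply: leq_trans hI; apply: eq_leq; rewrite /threshold_ratio; ring.
have large := classes_large r0 card_part adj_part density_part m0 J_large mono_small d_small.
have completeJ :=
  ordered_parts_complete r0 card_part density_part sortedJ (ltn0Sn _) maxcut rich0 large.
have unifJ :=
  ordered_parts_uniform r0 card_part density_part sortedJ (ltn0Sn _) maxcut rich0 large.
pose J' := [set i in J | uniform (class_size p col i)].
have sJ' : {subset J' <= J} by move=> i; rewrite inE => /andP[].
have cJ' : #|J| - 1 <= #|J'|.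
  have : #|J :\: J'| <= 1.
    rewrite leqNgt; apply/negP => /card_gt1P[i [j []]].
    rewrite !in_setD [i \in J']inE [j \in J']inE => /andP[+ iJ] /andP[+ jJ] ij.
    by rewrite iJ jJ /= => ui uj; have := unifJ i j iJ jJ ij; rewrite (negbTE ui) (negbTE uj).
  have := cardsID J' J; rewrite (setIidPr _); last by apply/subsetP.
  lia.
have J64 : 64 <= #|J| by apply: leq_trans J_large; rewrite leq_pmulr // expn_gt0 r0.
have /card_gt0P[i0 i0J'] : 0 < #|J'| by move: J64 cJ'; clear; lia.
pose q := class_size p col i0 (Ordinal r0).
have class_q i t : i \in J' -> r * class_size p col i t = m.
  rewrite inE => /andP[_ /uniformP u]; rewrite -(sum_class_size card_part col i).
  by rewrite (eq_bigr (fun=> class_size p col i t)) ?sum_nat_const ?card_ord.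
have mq : m = r * q by rewrite class_q.
apply: (@core_extends T G r l m p r0 card_part m0 density_part col J' d q) => //.
- by move=> i t iJ; apply/eqP; rewrite -(eqn_pmul2l r0) class_q // -mq.
- by move=> x y /sJ' xJ /sJ' yJ; apply: completeJ.
- have q0 : 0 < q by move: m0; rewrite mq muln_gt0 => /andP[].
  have : #|J| * q <= (#|J'| - 1) * q + 2 * q.
    by rewrite -mulnDl leq_mul2r; apply/orP; right; move: cJ'; clear; lia.
  have NE : N = r * (#|J| * q) by rewrite /N mq; ring.
  have d8 : 8 * d <= #|J| * q + 8.
    rewrite -(leq_pmul2l r0) mulnDr -NE.
    by apply: leq_trans (leq_trans d_small _); apply: eq_leq; ring.
  have X64 : 64 * q <= #|J| * q by rewrite leq_mul2r J64 orbT.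
  by move: d8 X64 q0; move: (#|J| * q) ((_ - 1) * q); clear=> *; lia.
Qed.

End ProperColoring.

(** * From a proper coloring to the extremal family *)

(** Extend one point at a time, composing with the transposition that corrects
    the value at the new point. *)
Lemma perm_extend (T : finType) (A : {set T}) (f : T -> T) :
  {in A &, injective f} -> exists t : {perm T}, {in A, t =1 f}.
Proof.
move: {2}#|A| (erefl #|A|) => n; elim: n A => [|n IH] A cA injf.
  by exists 1%g => x; rewrite (cards0_eq cA) inE.
have /card_gt0P[a aA] : 0 < #|A| by rewrite cA.
have [|x y|t ht] := IH (A :\ a).
- by move: cA; rewrite (cardsD1 a) aA => -[].
- by rewrite !inE => /andP[_ xA] /andP[_ yA]; apply: injf.
exists (t * tperm (t a) (f a))%g => x xA; rewrite permM.
have [->|xa] := eqVneq x a; first by rewrite tpermL.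
rewrite -[RHS]ht ?inE ?xa // tpermD //.
  by apply: contra xa => /eqP/perm_inj ->.
rewrite ht ?inE ?xa //; apply: contra xa => /eqP e; apply/eqP.
by apply: injf.
Qed.

Section Family.

Variables (T : finType) (G : graph T) (r l m : nat) (p : T -> 'I_l).
Hypothesis r0 : 0 < r.
Hypothesis rl : r`! <= l.
Hypothesis m0 : 0 < m.
Hypothesis card_part : forall i, #|part p i| = m.
Hypothesis adj_part : forall x y, G x y -> p x != p y.
Hypothesis density_part : forall i j, i != j ->
  r.-1 * m ^ 2 <= r * edges G (part p i) (part p j).
Variable c : T -> 'I_r.
Hypothesis properc : forall x y, G x y -> c x != c y.

Let cs := class_size p c.

Lemma proper_density i j : i != j ->
  r * miss G c (part p i) (part p j) + r * (\sum_s cs i s * cs j s) <= m ^ 2.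
Proof.
move=> ij; have := class_size_density r0 card_part density_part c ij.
rewrite [mono _ _ _ _]big1 ?muln0 ?addn0 // => x _; rewrite big1 // => y _.
by case: (boolP (G x y)) => //= /properc /negbTE ->.
Qed.

Lemma uniform_class i t : uniform (cs i) -> r * cs i t = m.
Proof.
move=> /uniformP u; rewrite -(sum_class_size card_part c i).
by rewrite (eq_bigr (fun=> cs i t)) ?sum_nat_const ?card_ord.
Qed.

(** If one of two parts is uniform, the scalar product of their class sizes equals
    m^2 / r, which leaves no room for missing pairs. *)
Lemma uniform_complete x y : uniform (cs (p x)) -> p x != p y -> c x != c y -> G x y.
Proof.
move=> u xy cxy; have := proper_density xy.
have -> : r * (\sum_s cs (p x) s * cs (p y) s) = m ^ 2.
  rewrite big_distrr /= (eq_bigr (fun s => m * cs (p y) s)); last first.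
    by move=> s _; rewrite mulnA uniform_class.
  by rewrite -big_distrr /= (sum_class_size card_part) mulnn.
rewrite -[X in _ <= X]add0n leq_add2r leqn0 muln_eq0 eqn0Ngt r0 /= sum_nat_eq0.
move/forall_inP => /(_ x); rewrite inE eqxx => /(_ isT).
rewrite sum_nat_eq0 => /forall_inP/(_ y); rewrite inE eqxx => /(_ isT).
by rewrite cxy andbT; case: (G x y).
Qed.

(** Two parts with the same ranking attain equality in Chebyshev's inequality. *)
Lemma same_order_uniform (s : 'S_r) i j : sorted_by s (cs i) -> sorted_by s (cs j) ->
  i != j -> uniform (cs i) || uniform (cs j).
Proof.
move=> si sj ij; apply: (chebyshev_eq si sj); rewrite !(sum_class_size card_part).
by apply: leq_trans (proper_density ij); rewrite leq_addl.
Qed.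

(** Non-uniform parts have distinct rankings.  Sending such a part to the index
    that pi assigns to its ranking is therefore injective, and extends to a
    permutation of all parts.  Uniform parts satisfy the conditions at any
    index. *)
Lemma proper_coloring_in_family (pi : 'I_(r`!) -> 'S_r) : bijective pi ->
  exists (S : finType) (H : graph S), @Gfamily r.+1 l pi S H /\ isomorphic G H.
Proof.
move=> [pi' piK pi'K].
have [order horder] := fin_all_exists (fun i => sorted_by_exists (cs i)).
pose slot i : 'I_l := widen_ord rl (pi' (order i)).
have [|t ht] := @perm_extend _ [set i | ~~ uniform (cs i)] slot.
  move=> i j; rewrite !inE => ui uj /(congr1 val) /= /val_inj e.
  have {}e : order i = order j by rewrite -[order i]pi'K e pi'K.
  apply/eqP; apply: contraT => ij.
  have hj := horder j; rewrite -e in hj.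
  by have := same_order_uniform (horder i) hj ij; rewrite (negbTE ui) (negbTE uj).
have late_uniform i : r`! <= t i -> uniform (cs i).
  move=> ti; apply: contraT => ui; have := ht i; rewrite inE => /(_ ui) e.
  by move: ti; rewrite e /= leqNgt ltn_ord.
pose A (i : 'I_l) (s : 'I_r) := [set x in part p (t^-1 i)%g | c x == s].
pose n (i : 'I_l) (s : 'I_r) := #|A i s|.
have nE i : n i =1 cs (t^-1 i)%g by [].
pose tr := @triple r.+1 l n.
(* The triple (i, s, t) stands for the t-th vertex of color s in the part that is
   moved to index i; the graph H on triples is the pullback of G along g. *)
pose g (x : tr) : T := enum_val (tagged (tagged x)).
have gA x : g x \in A (tag x) (tag (tagged x)) by apply: enum_valP.
have pg x : p (g x) = (t^-1 (tag x))%g.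
  by have := gA x; rewrite !inE => /andP[/eqP].
have cg x : c (g x) = tag (tagged x).
  by have := gA x; rewrite !inE => /andP[_ /eqP].
have injg : injective g.
  move=> x y e; have e1 : tag x = tag y by apply: (@perm_inj _ t^-1%g); rewrite -!pg e.
  have e2 : tag (tagged x) = tag (tagged y) by rewrite -!cg e.
  move: x y e e1 e2 {pg cg gA} => [i [s a]] [j [s' b]] /= e e1 e2.
  by subst j s'; have -> : a = b := enum_val_inj e.
have hA y : y \in A (t (p y)) (c y) by rewrite !inE permK !eqxx.
pose h y : tr := Tagged _ (Tagged (fun s => 'I_(n (t (p y)) s)) (enum_rank_in (hA y) y)).
have hK : cancel h g by move=> y; rewrite /g /= enum_rankK_in.
have gK : cancel g h by move=> x; apply: injg; rewrite hK.
have Hsym : symmetric (fun a b : tr => G (g a) (g b)) by move=> a b; rewrite adj_sym.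
have Hirr : irreflexive (fun a b : tr => G (g a) (g b)) by move=> a; rewrite adj_irr.
pose H := Graph Hsym Hirr.
exists tr, H; split; last first.
  by exists h; [exists g | move=> x y; rewrite /= !hK].
apply: Gfamily_intro.
- split.
  + move=> i j ij a b ab; rewrite !nE.
    have [u|u] := boolP (uniform (cs (t^-1 i)%g)).
      by move/uniformP: u => /(_ (pi j b) (pi j a)) ->.
    have e := ht (t^-1 i)%g; rewrite inE permKV in e.
    have {}e := congr1 val (e u).
    have ej : j = pi' (order (t^-1 i)%g) by apply: val_inj; rewrite /= -ij.
    by rewrite ej pi'K; apply: horder.
  + move=> i ri s s'; rewrite !nE.
    have u : uniform (cs (t^-1 i)%g) by apply: late_uniform; rewrite permKV.
    split; first by move/uniformP: u.
    by move: m0; rewrite -(uniform_class s u) muln_gt0 => /andP[].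
  + by move=> i; rewrite -[X in _ < X]/(\sum_s cs _ s) (sum_class_size card_part).
- split=> [a b /= ab|a b].
    rewrite /Gbar_adj /fst_index /snd_index -!cg (properc ab) andbT.
    by have := adj_part ab; rewrite !pg (inj_eq perm_inj).
  rewrite /= /Gbar_adj => /andP[ab]; rewrite /snd_index -!cg => cab nab.
  have pab : p (g a) != p (g b) by rewrite !pg (inj_eq perm_inj).
  split; rewrite ltnNge; apply: contra nab => late.
    by apply: uniform_complete => //; apply: late_uniform; rewrite pg permKV.
  rewrite adj_sym; apply: uniform_complete; rewrite 1?eq_sym //.
  by apply: late_uniform; rewrite pg permKV.
Qed.

End Family.

(** * The dichotomy *)

Import Order.TTheory GRing.Theory Num.Theory.

Local Open Scope ring_scope.

Lemma density_edges (T : finType) (G : graph T) (A B : {set T}) (a b m : nat) :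
    (0 < m)%N -> (0 < b)%N -> #|A| = m -> #|B| = m ->
    a%:R / b%:R <= density G A B ->
  (a * m ^ 2 <= b * edges G A B)%N.
Proof.
move=> m0 b0 cA cB; rewrite /density cA cB edgesE.
rewrite ler_pdivrMr ?ltr0n // mulrAC ler_pdivlMr ?ltr0n ?muln_gt0 ?m0 //.
by rewrite -!natrM ler_nat mulnn [(_ * b)%N]mulnC.
Qed.

Theorem theorem1p5 (k l n : nat) (hk : (3 <= k)%N) (hl : (k ^ (12 * k) <= l)%N)
    (pi : 'I_(k.-1)`! -> 'S_k.-1) (hpi : bijective pi)
    (T : finType) (G : graph T) (V : 'I_l -> {set T})
    (hn : #|T| = n) (hV : partite G V) (hbal : balanced V)
    (hd : forall i j : 'I_l, i != j ->
       (k - 2)%:R / (k - 1)%:R <= density G (V i) (V j)) :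
  (exists F : {set {set T}},
     (k%:R ^- (2 * k ^ 2) * n%:R ^+ (k - 2) <= #|F|%:R :> rat) /\
     (exists x y : T, G x y /\
        forall K : {set T}, K \in F ->
          [/\ clique G K, #|K| = k, x \in K & y \in K]))
  \/
  (exists (S : finType) (H : graph S), Gfamily k l pi H /\ isomorphic G H).
Proof.
case: k hk hl pi hpi hd => [//|r] hk hl pi hpi hd.
have r2 : (2 <= r)%N by [].
have r0 : (0 < r)%N by apply: leq_trans r2.
have ek : (r.+1 - 2)%N = r.-1 by lia.
have ek1 : (r.+1 - 1)%N = r by lia.
rewrite ek ek1 in hd *.
have [/existsP[x /existsP[y /andP[xy big]]]|nojoint] := boolP [exists x, exists y,
    G x y && (#|T| ^ r.-1 <= #|joint G r.+1 x y| * r.+1 ^ (2 * r.+1 ^ 2))%N].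
  left; exists (joint G r.+1 x y); split.
    rewrite ler_pdivrMl ?exprn_gt0 ?ltr0n // -!natrX -natrM ler_nat -hn.
    by rewrite [X in (_ <= X)%N]mulnC.
  exists x, y; split=> // K; rewrite inE => /and4P[/is_cliqueP cK /eqP nK xK yK].
  by split.
right; have l0 : (0 < l)%N by apply: leq_trans hl; rewrite expn_gt0.
case: hV => [coverV disjV V0 indV].
have cover x : exists i, x \in V i.
  have : x \in \bigcup_i V i by rewrite coverV inE.
  by case/bigcupP => i _ xi; exists i.
have [p hp] := fin_all_exists cover.
have partV i : part p i = V i.
  apply/setP => x; rewrite inE; apply/eqP/idP => [<- //|xi].
  apply/eqP; apply: contraT => ne; have := disjV _ _ ne.
  by move/pred0P => /(_ x); rewrite /= hp xi.
pose m := #|V (Ordinal l0)|.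
have m0 : (0 < m)%N by rewrite card_gt0.
have cV i : #|V i| = m by apply: hbal.
have card_part i : #|part p i| = m by rewrite partV.
have adj_part x y : G x y -> p x != p y.
  move=> xy; apply: contraL xy => /eqP e; apply: (indV (p x)) => //.
  by rewrite e.
have density_part i j : i != j -> (r.-1 * m ^ 2 <= r * edges G (part p i) (part p j))%N.
  by move=> /hd; rewrite !partV; apply: density_edges.
have nj x y : G x y -> (#|joint G r.+1 x y| * r.+1 ^ (2 * r.+1 ^ 2) < #|T| ^ r.-1)%N.
  move=> xy; rewrite ltnNge; apply: contra nojoint => h.
  by apply/existsP; exists x; apply/existsP; exists y; rewrite xy.
have [c properc] := proper_coloring r2 hl m0 card_part adj_part density_part nj.
have rl : (r`! <= l)%N.
  apply: leq_trans hl; apply: leq_trans (fact_le_exp r0) _.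
  apply: (@leq_trans (r.+1 ^ r.-1)); first by case: (r.-1) => // q; rewrite leq_exp2r.
  by rewrite leq_exp2l //; lia.
exact: (proper_coloring_in_family r0 rl m0 card_part adj_part density_part properc hpi).
Qed.
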